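(* Suppose that the weight sequences $\{M_p\}_{p\in\mathbb{N}}$ and $\{N_p\}_{p\in\mathbb{N}}$ satisfy $(M.1)$ and $(M.2)$, and assume in addition that $\inf_{p}\sqrt[p]{N_p}>0$. Set $A_p=N_p\max_{j\le p}(M_j/j!)$. Let $\ast,\dagger,\sharp$ stand simultaneously for $(M_p),(N_p),(A_p)$ (Beurling case) or for $\{M_p\},\{N_p\},\{A_p\}$ (Roumieu case). Then any element $f\in\mathcal{K}'^{\ast}_{\dagger}(\mathbb{R}^{d})$ satisfies the uniform moment asymptotic expansion (UMAE) in $\mathcal{K}'^{\ast}_{\dagger}(\mathbb{R}^{d})$ with respect to $\sharp$.
   Context: Weight sequences are sequences of positive real numbers indexed by $\mathbb{N}\ni0$; $M_\alpha:=M_{|\alpha|}$ for $\alpha\in\mathbb{N}^d$. Conditions (stated for $M_p$, likewise for $N_p$): - $(M.1)$: $M_p^2\le M_{p-1}M_{p+1}$ for $p\ge1$. - $(M.2)$: $M_{p+q}\le AH^{p+q}M_pM_q$, $p,q\in\mathbb{N}$, for certain constants $A,H$. The associated function of $N_p$ is $N(t)=\sup_{p\in\mathbb{N}}\log\frac{t^pN_0}{N_p}$, $t\ge0$. The space $\mathcal{K}^{\ast}_{\dagger}(\mathbb{R}^d)$. For $q,\ell>0$, $\mathcal{K}^{M_p,\ell}_{N_p,q}(\mathbb{R}^d)$ is the Banach space of all $\varphi\in C^\infty(\mathbb{R}^d)$ for which $$\|\varphi\|_{\mathcal{K}^{M_p,\ell}_{N_p,q}(\mathbb{R}^d)}=\sup_{\alpha\in\mathbb{N}^d}\sup_{x\in\mathbb{R}^d}\frac{e^{-N(q|x|)}(1+|x|)^{|\alpha|}|\varphi^{(\alpha)}(x)|}{\ell^{|\alpha|}M_\alpha}<\infty.$$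 Then $$\mathcal{K}^{(M_p)}_{(N_p)}(\mathbb{R}^d)=\varinjlim_{q\to\infty}\varprojlim_{\ell\to0^+}\mathcal{K}^{M_p,\ell}_{N_p,q}(\mathbb{R}^d),\qquad\mathcal{K}^{\{M_p\}}_{\{N_p\}}(\mathbb{R}^d)=\varinjlim_{\ell\to\infty}\varprojlim_{q\to0^+}\mathcal{K}^{M_p,\ell}_{N_p,q}(\mathbb{R}^d),$$ and $\mathcal{K}'^{\ast}_{\dagger}(\mathbb{R}^d)$ is the dual of $\mathcal{K}^{\ast}_{\dagger}(\mathbb{R}^d)$. UMAE. Let $\mathcal{X}$ be a locally convex space of smooth functions on $\mathbb{R}^d$ on which the dilation operators and the Dirac delta and all its partial derivatives act continuously. An element $f\in\mathcal{X}'$ satisfies the UMAE in $\mathcal{X}'$ with respect to $\sharp$ if there are $\mu_\alpha\in\mathbb{C}$, $\alpha\in\mathbb{N}^d$, such that for any $\varphi\in\mathcal{X}$ and each $\ell>0$ in the Beurling case (for some $\ell=\ell_\varphi>0$ in the Roumieu case) the asymptotic formula $$\langle f(\lambda x),\varphi(x)\rangle=\sum_{|\alpha|<k}\frac{\mu_\alpha\varphi^{(\alpha)}(0)}{\alpha!\,\lambda^{|\alpha|+d}}+O\!\left(\frac{\ell^kA_k}{\lambda^{k+d}}\right),\qquad\lambda\to\infty,$$ holds uniformly for $k\in\mathbb{N}$ (the implied constant and the range of $\lambda$ do not depend on $k$). Here $\langle f(\lambda x),\varphi(x)\rangle=\lambda^{-d}\langle f(x),\varphi(x/\lambda)\rangle$.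 *)

(* Defs.v *)
From HB Require Import structures.
From mathcomp Require Import all_boot all_order all_algebra.
From mathcomp Require Import complex.
From mathcomp Require Import all_classical all_reals all_analysis.

Set Implicit Arguments.
Unset Strict Implicit.
Unset Printing Implicit Defensive.

Import Order.TTheory GRing.Theory Num.Theory.
Import numFieldNormedType.Exports.

Local Open Scope classical_set_scope.
Local Open Scope ring_scope.

(** * Weight sequences *)

Definition weight_seq (R : realType) (M : nat -> R) : Prop :=
  forall p : nat, 0 < M p.

Definition cond_M1 (R : realType) (M : nat -> R) : Prop :=
  forall p : nat, (1 <= p)%N -> M p ^+ 2 <= M p.-1 * M p.+1.

Definition cond_M2 (R : realType) (M : nat -> R) : Prop :=
  exists A H : R, forall p q : nat,
    M (p + q)%N <= A * H ^+ (p + q) * M p * M q.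

(* [lne 0 = -oo]; the value is [+oo] for large [t] when the quotients
   [N p.+1 / N p] are bounded. *)
Definition assoc_fun (R : realType) (N : nat -> R) (t : R) : \bar R :=
  ereal_sup [set lne (t ^+ p * N 0%N / N p)%:E | p in [set: nat]].

(* The terms of the maximum are positive, so its neutral element 0 is harmless. *)
Definition A_seq (R : realType) (M N : nat -> R) (p : nat) : R :=
  N p * \big[Num.max/0]_(j < p.+1) (M j / (j`!)%:R).

(** * Smooth complex-valued functions on R^d *)

(* ['rV[R]_d] carries the max norm in the library; its topology is the usual
   one, but |x| has to be the Euclidean norm. *)
Definition enorm (R : realType) (d : nat) (x : 'rV[R]_d) : R :=
  Num.sqrt (\sum_(i < d) x ord0 i ^+ 2).

Definition multi_index (d : nat) := {ffun 'I_d -> nat}.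

Definition mi_order (d : nat) (a : multi_index d) : nat := (\sum_(i < d) a i)%N.

Definition mi_fact (d : nat) (a : multi_index d) : nat :=
  (\prod_(i < d) (a i)`!)%N.

Definition pderiv (R : realType) (d : nat) (i : 'I_d) (g : 'rV[R]_d -> R) :
    'rV[R]_d -> R :=
  fun x => 'D_(delta_mx ord0 i) g x.

(* C^oo: all iterated partial derivatives, in any order, exist and are
   continuous. *)
Definition rsmooth (R : realType) (d : nat) (g : 'rV[R]_d -> R) : Prop :=
  forall s : seq 'I_d,
    let h := foldr (@pderiv R d) g s in
    continuous h /\
    forall (i : 'I_d) (x : 'rV[R]_d), derivable h x (delta_mx ord0 i).

Definition rmderiv (R : realType) (d : nat) (a : multi_index d)
    (g : 'rV[R]_d -> R) : 'rV[R]_d -> R :=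
  foldr (fun i h => iter (a i) (pderiv i) h) g (enum 'I_d).

(* [R[i]] is a normed space over itself only, not over [R], hence real and
   imaginary parts are differentiated separately. *)
Definition csmooth (R : realType) (d : nat) (phi : 'rV[R]_d -> R[i]) : Prop :=
  rsmooth (fun x => complex.Re (phi x)) /\ rsmooth (fun x => complex.Im (phi x)).

Definition mderiv (R : realType) (d : nat) (a : multi_index d)
    (phi : 'rV[R]_d -> R[i]) : 'rV[R]_d -> R[i] :=
  fun x => Complex (rmderiv a (fun y => complex.Re (phi y)) x)
                   (rmderiv a (fun y => complex.Im (phi y)) x).

(* The R-valued modulus ([`|z|] is [R[i]]-valued). *)
Notation cmod := Normc.normc.

(** * The spaces K *)

(* Extended-real valued; [expeR (- +oo) = 0] and [0 * r = 0]. *)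
Definition Knorm (R : realType) (d : nat) (M N : nat -> R) (l q : R)
    (phi : 'rV[R]_d -> R[i]) : \bar R :=
  ereal_sup [set
    ereal_sup [set
      (expeR (- assoc_fun N (q * enorm x)) *
       ((1 + enorm x) ^+ mi_order a * cmod (mderiv a phi x)
         / (l ^+ mi_order a * M (mi_order a)))%:E)%E
      | x in [set: 'rV[R]_d]]
    | a in [set: multi_index d]].

Inductive ultra_class := Beurling | Roumieu.

(* [s] is the index of the inductive limit ([s --> +oo]) and [t] that of the
   projective limit ([t --> 0+]): [(q, l)] in the Beurling case and [(l, q)] in
   the Roumieu case. *)
Definition Kseminorm (R : realType) (d : nat) (c : ultra_class) (M N : nat -> R)
    (s t : R) (phi : 'rV[R]_d -> R[i]) : \bar R :=
  match c with
  | Beurling => Knorm M N t s phi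
  | Roumieu => Knorm M N s t phi
  end.

Definition Kstep (R : realType) (d : nat) (c : ultra_class) (M N : nat -> R)
    (s : R) : set ('rV[R]_d -> R[i]) :=
  [set phi | csmooth phi /\
             forall t : R, 0 < t -> (Kseminorm c M N s t phi < +oo)%E].

Definition Kspace (R : realType) (d : nat) (c : ultra_class) (M N : nat -> R) :
    set ('rV[R]_d -> R[i]) :=
  \bigcup_(s in [set s : R | 0 < s]) @Kstep R d c M N s.

(* Neighbourhoods of 0 in the projective limit [Kstep c M N s]. *)
Definition Kstep_nbhs0 (R : realType) (d : nat) (c : ultra_class)
    (M N : nat -> R) (s : R) (U : set ('rV[R]_d -> R[i])) : Prop :=
  exists (ts : seq R) (e : R),
    [/\ forall t, t \in ts -> 0 < t, 0 < e &
      [set phi | @Kstep R d c M N s phi /\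
                 forall t, t \in ts -> (Kseminorm c M N s t phi < e%:E)%E]
        `<=` U].

Definition abs_convex (R : realType) (d : nat) (V : set ('rV[R]_d -> R[i])) :
    Prop :=
  forall (phi psi : 'rV[R]_d -> R[i]) (a b : R[i]), V phi -> V psi ->
    cmod a + cmod b <= 1 -> V (fun x => a * phi x + b * psi x).

(* Neighbourhoods of 0 in the locally convex inductive limit [Kspace c M N],
   i.e. for the finest locally convex topology for which the inclusions of the
   steps are continuous. *)
Definition Kspace_nbhs0 (R : realType) (d : nat) (c : ultra_class)
    (M N : nat -> R) (U : set ('rV[R]_d -> R[i])) : Prop :=
  exists V : set ('rV[R]_d -> R[i]),
    [/\ V `<=` U, V `<=` @Kspace R d c M N, abs_convex V &
        forall s : R, 0 < s ->
          Kstep_nbhs0 c M N s (V `&` @Kstep R d c M N s)].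

(* A functional on [Kspace c M N] is represented by a map on all functions,
   whose values outside [Kspace c M N] are irrelevant. By linearity, continuity
   amounts to continuity at 0. *)
Definition Kdual (R : realType) (d : nat) (c : ultra_class) (M N : nat -> R) :
    set (('rV[R]_d -> R[i]) -> R[i]) :=
  [set f |
    (forall (phi psi : 'rV[R]_d -> R[i]) (a b : R[i]),
      @Kspace R d c M N phi -> @Kspace R d c M N psi ->
      f (fun x => a * phi x + b * psi x) = a * f phi + b * f psi) /\
    (forall e : R, 0 < e ->
      Kspace_nbhs0 c M N [set phi | @Kspace R d c M N phi /\ cmod (f phi) < e])].

(** * The uniform moment asymptotic expansion *)

(* <f(lam x), phi(x)> *)
Definition dilated_pairing (R : realType) (d : nat)
    (f : ('rV[R]_d -> R[i]) -> R[i]) (lam : R) (phi : 'rV[R]_d -> R[i]) : R[i] :=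
  real_complex R (lam ^- d) * f (fun x => phi (lam^-1 *: x)).

(* All entries of a multi-index of order < k are < k, so these multi-indices
   are found among the maps ['I_d -> 'I_k]. *)
Definition moment_sum (R : realType) (d : nat) (mu : multi_index d -> R[i])
    (phi : 'rV[R]_d -> R[i]) (lam : R) (k : nat) : R[i] :=
  \sum_(b : {ffun 'I_d -> 'I_k} |
        (mi_order [ffun i => nat_of_ord (b i)] < k)%N)
    let a : multi_index d := [ffun i => nat_of_ord (b i)] in
    mu a * mderiv a phi 0
      / ((mi_fact a)%:R * real_complex R (lam ^+ (mi_order a + d))).

Definition UMAE_estimate (R : realType) (d : nat) (A : nat -> R)
    (f : ('rV[R]_d -> R[i]) -> R[i]) (mu : multi_index d -> R[i])
    (phi : 'rV[R]_d -> R[i]) (l : R) : Prop :=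
  exists C lam0 : R, 0 < lam0 /\
    forall (k : nat) (lam : R), lam0 <= lam ->
      cmod (dilated_pairing f lam phi - moment_sum mu phi lam k)
        <= C * (l ^+ k * A k / lam ^+ (k + d)).

Definition UMAE (R : realType) (d : nat) (c : ultra_class)
    (X : set ('rV[R]_d -> R[i])) (A : nat -> R)
    (f : ('rV[R]_d -> R[i]) -> R[i]) : Prop :=
  exists mu : multi_index d -> R[i],
    forall phi : 'rV[R]_d -> R[i], X phi ->
      match c with
      | Beurling => forall l : R, 0 < l -> UMAE_estimate A f mu phi l
      | Roumieu => exists2 l : R, 0 < l & UMAE_estimate A f mu phi l
      end.

(* Main.v *)
Require Import Defs.
From HB Require Import structures.
From mathcomp Require Import all_boot all_order all_algebra.
From mathcomp Require Import complex.
From mathcomp Require Import all_classical all_reals all_analysis.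
From mathcomp Require Import ring lra.

Set Implicit Arguments.
Unset Strict Implicit.
Unset Printing Implicit Defensive.

Import Order.TTheory GRing.Theory Num.Theory.
Import numFieldNormedType.Exports.

Local Open Scope classical_set_scope.
Local Open Scope ring_scope.

(** With [mu_a = <f, x^a>], the error of the expansion at order [k] is
    [lam^-d <f, psi>], where [psi] is the dilated Taylor remainder
    [R_k phi (x / lam)].  So it suffices to bound the norms of [psi] by
    [C l^k A_k / lam^k].  The derivatives of [psi] of order [b >= k] are dilated
    derivatives of [phi].  Those of order [b < k] are dilated Taylor remainders of
    order [m = k - b] of derivatives of [phi], hence bounded by
    [(d |x| / lam)^m / m!] times a bound on the derivatives of order [k]; by
    (M.2), [M_k / m! <= A H^k M_b max_(j <= k) M_j / j!].  Finally (M.2) for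
    [N] gives [2 N(t) <= N(H t) + const]: one copy of [N] absorbs the growth of
    [phi], the other one the factor [(1 + |x|)^k], at the price of [N_k]. *)

(** The obstacle is the low orders: the remainder at [x] depends on derivatives of [phi] on a whole
    box reaching down to 0, where the factor [(1 + |z|)^k] in the norm gives no decay. The full
    power [(1 + |x|)^k] therefore has to be paid for by the weight. This costs
    [2^k (1 + N_k / (N_0 q^k))], and the lower bound on the roots of [N_p] serves to absorb the
    summand 1 into a multiple of [D^k N_k]. Comparing a bound with [l^k] to a norm with [l'^b], for
    orders [b] unrelated to [k], costs a further factor [(1 + 1/l')^k]. It is harmless because it is
    geometric in [k] and depends on [l'] alone. Partial derivatives must commute because the Taylor
    estimate, made one coordinate at a time, produces them in arbitrary order, whereas the norms
    only measure those taken in the order of the coordinates. *)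

Local Notation ebasis i := (delta_mx ord0 i).

(** * Commutation of partial derivatives *)

Lemma is_derive_line (R : realType) (V : normedModType R) (g : V -> R)
    (x v : V) (t : R) :
  derivable g (x + t *: v) v ->
  is_derive t 1 (fun u => g (x + u *: v)) ('D_v g (x + t *: v)).
Proof.
move=> dg.
have E : (fun h : R => h^-1 *: (((fun u => g (x + u *: v)) \o shift t) (h *: 1) -
      g (x + t *: v))) =
    (fun h : R => h^-1 *: ((g \o shift (x + t *: v)) (h *: v) - g (x + t *: v))).
  apply/funext => h /=; congr (_ *: (g _ - _)).
  by rewrite [h *: 1]mulr1 scalerDl addrCA.
by apply: DeriveDef; rewrite ?/derivable ?/derive E.
Qed.

Lemma MVT_line (R : realType) (V : normedModType R) (g : V -> R) (x v : V)
    (h : R) :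
  0 < h -> (forall t, derivable g (x + t *: v) v) ->
  exists2 t, 0 < t < h & g (x + h *: v) - g x = h * 'D_v g (x + t *: v).
Proof.
move=> h0 dg.
have [||t] := @MVT R (fun u => g (x + u *: v)) (fun u => 'D_v g (x + u *: v)) _ _ h0.
- by move=> t _; exact: is_derive_line.
- apply: derivable_within_continuous => t _.
  by have [] := is_derive_line (dg t).
rewrite in_itv /= => ht E; exists t => //.
by move: E; rewrite scale0r addr0 subr0 mulrC.
Qed.

Lemma close_values (R : realType) (e a b c1 c2 : R) : c1 = c2 ->
  `|b - c1| < e / 2 -> `|a - c2| < e / 2 -> `|a - b| < e.
Proof. by move=> ->; rewrite !ltr_norml; lra. Qed.

Section Schwarz.
Variables (R : realType) (d : nat).
Implicit Types (g : 'rV[R]_d -> R) (x : 'rV[R]_d) (i j : 'I_d).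

Lemma rsmooth_derivable g i x : rsmooth g -> derivable g x (ebasis i).
Proof. by move=> /(_ [::])[_]; exact. Qed.

Lemma rsmooth_continuous g : rsmooth g -> continuous g.
Proof. by move=> /(_ [::])[]. Qed.

Lemma rsmooth_foldr g s : rsmooth g -> rsmooth (foldr (@pderiv R d) g s).
Proof. by move=> sg t; have := sg (t ++ s); rewrite foldr_cat. Qed.

Lemma rsmooth_pderiv g i : rsmooth g -> rsmooth (pderiv i g).
Proof. by move=> /(@rsmooth_foldr _ [:: i]). Qed.

Lemma pderivB g1 g2 i x :
  derivable g1 x (ebasis i) -> derivable g2 x (ebasis i) ->
  pderiv i (fun z => g1 z - g2 z) x = pderiv i g1 x - pderiv i g2 x.
Proof. by move=> d1 d2; rewrite /pderiv; exact: deriveB. Qed.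

Lemma growth_rate_shift g (a x v : 'rV[R]_d) :
  (fun h : R => h^-1 *: (((fun z => g (z + a)) \o shift x) (h *: v) - g (x + a))) =
  (fun h : R => h^-1 *: ((g \o shift (x + a)) (h *: v) - g (x + a))).
Proof. by apply/funext => h /=; rewrite addrA. Qed.

Lemma derivable_shift g (a x v : 'rV[R]_d) :
  derivable g (x + a) v -> derivable (fun z => g (z + a)) x v.
Proof. by rewrite /derivable growth_rate_shift. Qed.

Lemma pderiv_shift g (a : 'rV[R]_d) i :
  pderiv i (fun z => g (z + a)) = fun z => pderiv i g (z + a).
Proof. by apply/funext => x; rewrite /pderiv /derive growth_rate_shift. Qed.

(** The mean value theorem is used twice: along [ebasis i] for the increment of [g] in direction
    [ebasis j], then along [ebasis j] for [pderiv i g]. *)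
Lemma double_increment g x i j (h : R) : rsmooth g -> 0 < h ->
  exists t u : R, [/\ 0 < t < h, 0 < u < h &
    (g (x + h *: ebasis i + h *: ebasis j) - g (x + h *: ebasis i))
    - (g (x + h *: ebasis j) - g x) =
    h ^+ 2 * pderiv j (pderiv i g) (x + t *: ebasis i + u *: ebasis j)].
Proof.
move=> sg h0.
have dsh y : derivable (fun z => g (z + h *: ebasis j)) y (ebasis i).
  by apply: derivable_shift; exact: rsmooth_derivable.
have dg y : derivable g y (ebasis i) by exact: rsmooth_derivable.
have [t ht Et] := @MVT_line R _ (fun z => g (z + h *: ebasis j) - g z) x (ebasis i) h h0
  (fun t => derivableB (dsh _) (dg _)).
have [u hu Eu] := @MVT_line R _ (pderiv i g) (x + t *: ebasis i) (ebasis j) h h0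
   (fun t => rsmooth_derivable (rsmooth_pderiv i sg)).
exists t, u; split => //.
move: Et; rewrite /= -/(pderiv i _ _) pderivB // pderiv_shift Eu => ->.
by rewrite mulrA -expr2.
Qed.

(** The double increment is symmetric in [i] and [j], so the two mixed derivatives take a common
    value at suitable points arbitrarily close to [x]; continuity carries the equality to [x]. *)
Lemma pderivC g i j : rsmooth g -> pderiv i (pderiv j g) = pderiv j (pderiv i g).
Proof.
move=> sg; apply/funext => x.
suff H e : 0 < e -> `|pderiv i (pderiv j g) x - pderiv j (pderiv i g) x| < e.
  apply/eqP; rewrite -subr_eq0 -normr_le0; apply/ler_addgt0Pl => e e0.
  by rewrite addr0 ltW // H.
move=> e0.
have cont k l : \forall z \near x,
    `|pderiv k (pderiv l g) x - pderiv k (pderiv l g) z| < e / 2.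
  have /cvgrPdist_lt := rsmooth_continuous (rsmooth_pderiv k (rsmooth_pderiv l sg)) (x:=x).
  by apply; rewrite divr_gt0.
have /nbhs_normP[r r0 rP] : nbhs x [set z |
    `|pderiv i (pderiv j g) x - pderiv i (pderiv j g) z| < e / 2 /\
    `|pderiv j (pderiv i g) x - pderiv j (pderiv i g) z| < e / 2].
  exact: filterI (cont i j) (cont j i).
pose h := r / 2.
have h0 : 0 < h by rewrite divr_gt0.
have inball t u k l : 0 < t < h -> 0 < u < h ->
    `|x - (x + t *: ebasis k + u *: ebasis l)| < r.
  move=> /andP[t0 th] /andP[u0 uh].
  rewrite opprD opprD addrA addrA subrr sub0r -opprD normrN.
  rewrite (le_lt_trans (ler_normD _ _)) //.
  have nb k' : `|ebasis k' : 'rV[R]_d| <= 1.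
    rewrite [X in X <= _]mx_normrE; apply/bigmax_leP; split => // ij _.
    by rewrite mxE; case: (_ && _); rewrite ?normr1 ?normr0.
  rewrite !normrZ (gtr0_norm t0) (gtr0_norm u0).
  have : t * `|ebasis k : 'rV[R]_d| <= t by rewrite ler_piMr // ltW.
  have : u * `|ebasis l : 'rV[R]_d| <= u by rewrite ler_piMr // ltW.
  have : h + h = r by rewrite /h -splitr.
  lra.
have [t [u [ht hu E1]]] := double_increment x i j sg h0.
have [t' [u' [ht' hu' E2]]] := double_increment x j i sg h0.
have /= [_ H1] := rP _ (inball t u i j ht hu).
have /= [H2 _] := rP _ (inball t' u' j i ht' hu').
have E : pderiv j (pderiv i g) (x + t *: ebasis i + u *: ebasis j) =
         pderiv i (pderiv j g) (x + t' *: ebasis j + u' *: ebasis i).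
  have hh : h ^+ 2 != 0 by rewrite expf_neq0 // gt_eqF.
  apply: (mulfI hh).
  apply: etrans (esym E1) (etrans _ E2); clear.
  rewrite (addrAC x (h *: ebasis j)).
  move: (g _) (g _) (g _) (g _) => a1 a2 a3 a4.
  by rewrite !opprB addrACA [RHS]addrACA; congr (_ + _); rewrite addrC.
apply: close_values E H1 H2.
Qed.
End Schwarz.

(** * Multi-indices *)

Section IteratedDerivatives.
Variables (R : realType) (d : nat).
Implicit Types (g : 'rV[R]_d -> R) (i j : 'I_d) (s t : seq 'I_d)
  (a b : multi_index d).

Lemma foldr_pderiv_mid g s i t : rsmooth g ->
  foldr (@pderiv R d) g (s ++ i :: t) = pderiv i (foldr (@pderiv R d) g (s ++ t)).
Proof.
move=> sg; elim: s => //= j s ->.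
by apply: pderivC; exact: rsmooth_foldr.
Qed.

Lemma foldr_pderiv_perm g s t : rsmooth g -> perm_eq s t ->
  foldr (@pderiv R d) g s = foldr (@pderiv R d) g t.
Proof.
move=> sg; elim: s t => [|i s IH] t st.
  by move: st; rewrite perm_sym => /perm_nilP ->.
have : i \in t by rewrite -(perm_mem st) mem_head.
move=> it; case/splitPr: it st => t1 t2 st.
rewrite foldr_pderiv_mid //= (IH (t1 ++ t2)) //.
by rewrite -(perm_cons i) (perm_trans st) // -cat1s perm_catCA.
Qed.

(** Sequences of coordinates match the definition of [rsmooth] and compose by concatenation.
    [mi_seq] and [mi_of] translate between them and multi-indices up to permutation, which suffices
    by [foldr_pderiv_perm]. *)
Definition mi_seq a : seq 'I_d := flatten [seq nseq (a i) i | i <- enum 'I_d].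

Definition mi_of s : multi_index d := [ffun i => count_mem i s].

Definition mi_pred i a : multi_index d := [ffun j => a j - (i == j)]%N.

Definition mi_succ i a : multi_index d := [ffun j => a j + (i == j)]%N.

Lemma count_mi_seq a i : count_mem i (mi_seq a) = a i.
Proof.
rewrite /mi_seq count_flatten -map_comp.
rewrite (eq_map (g := fun j => (j == i) * a j)%N); last first.
  by move=> j /=; rewrite count_nseq.
rewrite sumnE big_map big_enum /= (bigD1 i) //= eqxx mul1n.
by rewrite big1 ?addn0 // => j /negbTE ->.
Qed.

Lemma size_mi_seq a : size (mi_seq a) = mi_order a.
Proof.
rewrite /mi_seq size_flatten /shape -map_comp sumnE big_map big_enum /=.
by apply: eq_bigr => i _; rewrite size_nseq.
Qed.

Lemma perm_mi_of a s : (forall i, count_mem i s = a i) -> perm_eq (mi_seq a) s.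
Proof. by move=> H; apply/allP => i _; rewrite /= count_mi_seq H. Qed.

Lemma mi_order_mi_of s : mi_order (mi_of s) = size s.
Proof.
rewrite -size_mi_seq; apply: perm_size; apply: perm_mi_of => i.
by rewrite ffunE.
Qed.

Lemma mi_order_pred i a : a i != 0%N -> mi_order a = (mi_order (mi_pred i a)).+1.
Proof.
move=> ai; rewrite /mi_order (bigD1 i) //= [in RHS](bigD1 i) //= ffunE eqxx.
rewrite -addSn -subSn ?lt0n // subn1; congr addn; apply: eq_bigr => j ji.
by rewrite ffunE eq_sym (negbTE ji) subn0.
Qed.

Lemma mi_succK i a : mi_pred i (mi_succ i a) = a.
Proof. by apply/ffunP => j; rewrite !ffunE addnK. Qed.

Lemma mi_predK i a : a i != 0%N -> mi_succ i (mi_pred i a) = a.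
Proof.
move=> ai; apply/ffunP => j; rewrite !ffunE subnK //.
by case: eqP => // <-; rewrite lt0n.
Qed.

Lemma mi_succ_neq0 i a : mi_succ i a i != 0%N.
Proof. by rewrite ffunE eqxx addn1. Qed.

Lemma rmderivE a g : rmderiv a g = foldr (@pderiv R d) g (mi_seq a).
Proof.
rewrite /rmderiv /mi_seq; elim: (enum _) => //= i s ->.
rewrite foldr_cat; elim: (a i) => //= n IH; by rewrite -IH.
Qed.

Lemma foldr_pderivE s g : rsmooth g ->
  foldr (@pderiv R d) g s = rmderiv (mi_of s) g.
Proof.
move=> sg; rewrite rmderivE; apply: foldr_pderiv_perm => //.
by rewrite perm_sym; apply: perm_mi_of => i; rewrite ffunE.
Qed.

Lemma rmderiv_pred i a g : rsmooth g -> a i != 0%N ->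
  rmderiv a g = rmderiv (mi_pred i a) (pderiv i g).
Proof.
move=> sg ai; rewrite !rmderivE -[pderiv i g]/(foldr (@pderiv R d) g [:: i]).
rewrite -foldr_cat; apply: foldr_pderiv_perm => //.
apply: perm_mi_of => j; rewrite count_cat count_mi_seq ffunE /= addn0.
by rewrite subnK //; case: eqP => // <-; rewrite lt0n.
Qed.

(* A sequence rather than the index type of [moment_sum], since differentiation
   lowers the order by one and with it the bound on the entries. *)
Definition mis k : seq (multi_index d) :=
  [seq a <- [seq ([ffun i => nat_of_ord (b i)] : multi_index d)
    | b : {ffun 'I_d -> 'I_k}] | (mi_order a < k)%N].

Lemma mis_uniq k : uniq (mis k).
Proof.
apply: filter_uniq; apply/injectiveP => b c /ffunP bc.
by apply/ffunP => i; apply: val_inj; have := bc i; rewrite !ffunE.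
Qed.

Lemma mem_mis k a : (a \in mis k) = (mi_order a < k)%N.
Proof.
rewrite mem_filter andb_idr // => ak.
have ai i : (a i < k)%N.
  by apply: leq_ltn_trans ak; rewrite /mi_order (bigD1 i) //= leq_addr.
apply/mapP; exists [ffun i => Ordinal (ai i)]; first by rewrite mem_enum.
by apply/ffunP => i; rewrite !ffunE.
Qed.

Lemma big_mis (T : nmodType) k (F : multi_index d -> T) :
  \sum_(a <- mis k) F a =
  \sum_(b : {ffun 'I_d -> 'I_k} |
        (mi_order [ffun i => nat_of_ord (b i)] < k)%N)
    F [ffun i => nat_of_ord (b i)].
Proof. by rewrite big_filter big_map big_enum_cond. Qed.

(** The reindexing behind the derivative of a Taylor polynomial: [mi_pred i] is a bijection with
    inverse [mi_succ i] and lowers the order by one. For [k = 0] both sums are empty. *)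
Lemma big_mis_pred (T : nmodType) k i (F : multi_index d -> T) :
  \sum_(a <- mis k | a i != 0%N) F (mi_pred i a) = \sum_(b <- mis k.-1) F b.
Proof.
rewrite -big_filter -(big_map (mi_pred i) xpredT F); apply: perm_big.
apply: uniq_perm; [|exact: mis_uniq|].
  rewrite map_inj_in_uniq ?(filter_uniq _ (mis_uniq k)) // => a b.
  rewrite !mem_filter => /andP[ai _] /andP[bi _] ab.
  by rewrite -(mi_predK ai) -(mi_predK bi) ab.
move=> b; rewrite mem_mis; apply/mapP/idP => [[a]|bk].
  rewrite mem_filter mem_mis => /andP[ai ak] ->.
  by move: ak; rewrite (mi_order_pred ai); case: k.
exists (mi_succ i b); last by rewrite mi_succK.
rewrite mem_filter mem_mis mi_succ_neq0 /=.
by rewrite (@mi_order_pred i) ?mi_succ_neq0 // mi_succK; case: k bk.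
Qed.

End IteratedDerivatives.

(** * Growth estimates in one variable *)

Section Growth.
Variable R : realType.

Lemma is_derive_powfact (K s t : R) m :
  is_derive t 1 (fun t : R => K * ((s + t) ^+ m.+1 / m.+1`!%:R))
    (K * ((s + t) ^+ m / m`!%:R)).
Proof.
have H : is_derive t 1 ((fun t : R => s + t) ^+ m.+1)
    ((m.+1%:R * (s + t) ^+ m) *: (0 + 1)).
  exact: is_deriveX.
have := is_deriveZ (K / m.+1`!%:R) H.
set u := (X in is_derive _ _ X _ -> _); set v := (X in is_derive _ _ _ X -> _).
have -> : u = (fun t => K * ((s + t) ^+ m.+1 / m.+1`!%:R)).
  by apply/funext => z; rewrite /u /= exprfctE /= [_ *: _]mulrAC mulrA.
have -> // : v = K * ((s + t) ^+ m / m`!%:R).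
rewrite /v add0r !scaler1 [_ *: _]mulrC -mulrA [_ / _]mulrC.
rewrite factS natrM invfM.
have := fact_gt0 m; rewrite -(ltr0n R) => /lt0r_neq0 m0.
field; apply/andP; split; first exact: m0.
by rewrite addrC natr1 pnatr_eq0.
Qed.

(** With [v] the primitive of the majorant, [v + h] and [v - h] have nonnegative derivatives; the
    mean value theorem thus replaces integration, and [dh] need not be integrable. *)
Lemma growth_segment (h dh : R -> R) (K s t0 : R) m : 0 <= t0 ->
  (forall t : R, is_derive t 1 h (dh t)) ->
  (forall t, 0 <= t <= t0 -> `|dh t| <= K * ((s + t) ^+ m / m`!%:R)) ->
  `|h t0 - h 0| <=
    K * ((s + t0) ^+ m.+1 / m.+1`!%:R) - K * (s ^+ m.+1 / m.+1`!%:R).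
Proof.
move=> t00 hd dhK.
pose v t := K * ((s + t) ^+ m.+1 / m.+1`!%:R).
have vd (t : R) : is_derive t 1 v (K * ((s + t) ^+ m / m`!%:R)) by exact: is_derive_powfact.
have -> : K * (s ^+ m.+1 / m.+1`!%:R) = v 0 by rewrite /v addr0.
rewrite -/(v t0) ler_norml; apply/andP; split.
- have wd (t : R) : is_derive t 1 (v + h) (K * ((s + t) ^+ m / m`!%:R) + dh t).
    exact: is_deriveD.
  have [|c] := MVT_segment t00 (fun t _ => wd t).
    apply: derivable_within_continuous => t _; by have [] := wd t.
  rewrite in_itv /= => /[dup] /dhK; rewrite ler_norml => /andP[H _] _ E.
  have : 0 <= (v + h) t0 - (v + h) 0 by rewrite E subr0 mulr_ge0 //; lra.
  by rewrite !fctE; lra.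
- have wd (t : R) : is_derive t 1 (v - h) (K * ((s + t) ^+ m / m`!%:R) - dh t).
    exact: is_deriveB.
  have [|c] := MVT_segment t00 (fun t _ => wd t).
    apply: derivable_within_continuous => t _; by have [] := wd t.
  rewrite in_itv /= => /[dup] /dhK; rewrite ler_norml => /andP[_ H] _ E.
  have : 0 <= (v - h) t0 - (v - h) 0 by rewrite E subr0 mulr_ge0 //; lra.
  by rewrite !fctE; lra.
Qed.

Lemma growth_line (h dh : R -> R) (K s t0 : R) m :
  (forall t : R, is_derive t 1 h (dh t)) ->
  (forall t, `|t| <= `|t0| -> `|dh t| <= K * ((s + `|t|) ^+ m / m`!%:R)) ->
  `|h t0 - h 0| <=
    K * ((s + `|t0|) ^+ m.+1 / m.+1`!%:R) - K * (s ^+ m.+1 / m.+1`!%:R).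
Proof.
move=> hd dhK; have [t00|t00] := leP 0 t0.
  rewrite (ger0_norm t00); apply: (@growth_segment h dh) => // t /andP[t1 t2].
  by have := dhK t; rewrite (ger0_norm t1); apply; rewrite ger0_norm.
rewrite (ltr0_norm t00).
have := @growth_segment (fun t => h (- t)) (fun t => - dh (- t)) K s (- t0) m.
rewrite opprK oppr0; apply.
- by rewrite oppr_ge0 ltW.
- move=> t.
  have H : is_derive t 1 -%R (- 1 : R) by exact: is_deriveNid.
  have := is_derive1_comp (hd (- t)) H.
  by rewrite mulrN1.
- move=> t /andP[t1 t2]; rewrite normrN.
  have := dhK (- t); rewrite normrN (ger0_norm t1); apply.
  by rewrite ltr0_norm.
Qed.

End Growth.

(** * Taylor remainders *)

Section Taylor.
Variables (R : realType) (d : nat).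
Implicit Types (g : 'rV[R]_d -> R) (i j : 'I_d) (a b : multi_index d)
  (x y z : 'rV[R]_d).

(** The factorials are built in so that differentiation only lowers the index, without a numerical
    factor. *)
Definition emonom a y : R := \prod_(i < d) (y ord0 i ^+ a i / (a i)`!%:R).

Lemma emonom_line i a y t : emonom a (y + t *: ebasis i) =
  ((y ord0 i + t) ^+ a i / (a i)`!%:R) *
  \prod_(j < d | j != i) (y ord0 j ^+ a j / (a j)`!%:R).
Proof.
rewrite /emonom (bigD1 i) //= !mxE !eqxx /= mulr1; congr (_ * _).
by apply: eq_bigr => j ji; rewrite !mxE eqxx (negbTE ji) mulr0 addr0.
Qed.

Lemma is_derive_of_line g y v df :
  is_derive (0 : R) 1 (fun t : R => g (y + t *: v)) df -> is_derive y v g df.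
Proof.
have E : (fun h : R => h^-1 *: ((g \o shift y) (h *: v) - g y)) =
    (fun h : R => h^-1 *: (((fun u => g (y + u *: v)) \o shift 0) (h *: 1) -
      g (y + 0 *: v))).
  by apply/funext => h /=; rewrite scale0r !addr0 [h *: 1]mulr1 [y + _]addrC.
by case=> D1 D2; apply: DeriveDef; rewrite ?/derivable ?/derive E.
Qed.

Lemma is_derive_emonom i a y : is_derive y (ebasis i) (emonom a)
  (if a i == 0%N then 0 else emonom (mi_pred i a) y).
Proof.
apply: is_derive_of_line.
set c := \prod_(j < d | j != i) (y ord0 j ^+ a j / (a j)`!%:R).
have -> : (fun t : R => emonom a (y + t *: ebasis i)) =
    (fun t : R => c * ((y ord0 i + t) ^+ a i / (a i)`!%:R)).
  by apply/funext => t; rewrite emonom_line mulrC.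
case am : (a i) => [|m] /=.
  have -> : (fun t : R => c * ((y ord0 i + t) ^+ 0 / 0`!%:R)) = cst c.
    by apply/funext => t; rewrite expr0 fact0 divr1 mulr1.
  exact: is_derive_cst.
apply: is_derive_eq; first exact: is_derive_powfact.
rewrite addr0 /emonom [in RHS](bigD1 i) //= ffunE eqxx am subn1 /= mulrC.
congr (_ * _); apply: eq_bigr => j ji.
by rewrite ffunE eq_sym (negbTE ji) subn0.
Qed.

Lemma continuous_emonom a : continuous (emonom a).
Proof.
apply: continuous_big => [|i _ y]; first exact: mul_continuous.
have ci : {for y, continuous (fun y : 'rV[R]_d => y ord0 i ^+ a i)}.
  apply: (@continuous_comp _ _ _ (fun y : 'rV[R]_d => y ord0 i) (fun u : R => u ^+ a i)).
    exact: coord_continuous.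
  exact: exprn_continuous.
exact: cvgMr_tmp ci.
Qed.

Definition tpoly k g y : R := \sum_(a <- mis d k) rmderiv a g 0 * emonom a y.

Lemma tpoly0 g y : tpoly 0 g y = 0.
Proof.
rewrite /tpoly big_seq big1 // => a; by rewrite mem_mis.
Qed.

Lemma continuous_tpoly k g : continuous (tpoly k g).
Proof.
apply: continuous_big => [|a _ y]; first exact: add_continuous.
exact: (cvgMl_tmp (continuous_emonom (a:=a) (x:=y))).
Qed.

Definition trem k g y : R := g y - tpoly k g y.

Lemma is_derive_tpoly k g i y : rsmooth g ->
  is_derive y (ebasis i) (tpoly k g) (tpoly k.-1 (pderiv i g) y).
Proof.
move=> sg.
have : is_derive y (ebasis i) (tpoly k g)
  (\sum_(a <- mis d k) rmderiv a g 0 *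
     (if a i == 0%N then 0 else emonom (mi_pred i a) y)).
  rewrite /tpoly; elim: (mis d k) => [|a s IH].
    rewrite big_nil; under eq_fun do rewrite big_nil.
    exact: is_derive_cst.
  rewrite big_cons; under eq_fun do rewrite big_cons.
  apply: is_deriveD.
  by have := is_deriveZ (rmderiv a g 0) (is_derive_emonom i a y).
move=> H; apply: is_derive_eq H _.
rewrite /tpoly -(big_mis_pred _ i) [RHS]big_mkcond /=.
apply: eq_bigr => a _; case: eqP => [|/eqP ai] /=; first by rewrite mulr0.
by rewrite (rmderiv_pred sg ai).
Qed.

Lemma is_derive_trem k g i y : rsmooth g ->
  is_derive y (ebasis i) (trem k g) (trem k.-1 (pderiv i g) y).
Proof.
move=> sg; apply: is_deriveB; last exact: is_derive_tpoly.
exact/derivableP/rsmooth_derivable.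
Qed.

Lemma pderiv_trem k g i : rsmooth g ->
  pderiv i (trem k g) = trem k.-1 (pderiv i g).
Proof. by move=> sg; apply/funext => y; have [_] := is_derive_trem k i y sg. Qed.

(** The truncated subtraction is intended: [trem 0 h] is [h], so derivatives of order at least [k]
    are covered as well. *)
Lemma foldr_pderiv_trem k g s : rsmooth g ->
  foldr (@pderiv R d) (trem k g) s =
  trem (k - size s) (foldr (@pderiv R d) g s).
Proof.
move=> sg; elim: s => [|i s IH]; first by rewrite subn0.
by rewrite /= IH pderiv_trem ?subnS //; exact: rsmooth_foldr.
Qed.

Lemma rsmooth_trem k g : rsmooth g -> rsmooth (trem k g).
Proof.
move=> sg s /=; rewrite foldr_pderiv_trem //.
have := rsmooth_foldr s sg; move: (foldr _ g s) (k - size s)%N => h {sg k g} k sh.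
split=> [y|i y]; last by have [] := is_derive_trem k i y sh.
apply: continuousB; first exact: rsmooth_continuous.
exact: continuous_tpoly.
Qed.

Lemma emonom0 a : emonom a 0 = (mi_order a == 0%N)%:R.
Proof.
have [a0|a0] := eqVneq (mi_order a) 0%N.
  rewrite /emonom big1 // => i _; move/eqP: a0; rewrite sum_nat_eq0.
  by move=> /forallP /(_ i) /= /eqP ->; rewrite expr0 fact0 divr1.
have [i ai] : exists i, a i != 0%N.
  apply/existsP; move: a0; apply: contra_neqT; rewrite negb_exists => /forallP H.
  by rewrite /mi_order big1 // => i _; apply/eqP; have := H i; rewrite negbK.
by rewrite /emonom (bigD1 i) //= mxE expr0n (negbTE ai) mul0r mul0r.
Qed.

Lemma trem0 k g : trem k.+1 g 0 = 0.
Proof.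
rewrite /trem /tpoly (bigD1_seq [ffun=> 0%N]) ?mis_uniq ?mem_mis //=; last first.
  by rewrite /mi_order big1 // => i _; rewrite ffunE.
have o0 : mi_order ([ffun=> 0%N] : multi_index d) = 0%N.
  by rewrite /mi_order big1 // => i _; rewrite ffunE.
rewrite big1 => [|a a0]; last first.
  rewrite emonom0; case: eqP => [E|_]; last by rewrite mulr0.
  case/eqP: a0; apply/ffunP => i; rewrite ffunE.
  by move/eqP: E; rewrite sum_nat_eq0 => /forallP /(_ i) /= /eqP.
rewrite emonom0 o0 eqxx mulr1 addr0 rmderivE.
by rewrite (size0nil (s := mi_seq _)) ?subrr // size_mi_seq.
Qed.

Definition norm1 y : R := \sum_(i < d) `|y ord0 i|.

(** The path along the axes from 0 to [y] stays in this box, boxes are nested, and by [enorm_box] a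
    weight taken at [y] controls every point of it. *)
Definition in_box y z := forall i, `|z ord0 i| <= `|y ord0 i|.

(* Integrating along the axes one coordinate at a time needs neither total
   differentiability nor a chain rule, and the bounds telescope because [norm1]
   is additive along the path. *)
Lemma growth_box (F : 'rV[R]_d -> R) (dF : 'I_d -> 'rV[R]_d -> R) (K : R) m y :
  F 0 = 0 -> (forall i z, is_derive z (ebasis i) F (dF i z)) ->
  (forall i z, in_box y z -> `|dF i z| <= K * (norm1 z ^+ m / m`!%:R)) ->
  `|F y| <= K * (norm1 y ^+ m.+1 / m.+1`!%:R).
Proof.
move=> F0 FdF HK.
pose tr n : 'rV[R]_d := \row_(i < d) (if (i < n)%N then y ord0 i else 0).
have trd : tr d = y by apply/rowP => i; rewrite mxE ltn_ord.
suff H n : (n <= d)%N -> `|F (tr n)| <= K * (norm1 (tr n) ^+ m.+1 / m.+1`!%:R).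
  by have := H d (leqnn d); rewrite trd.
elim: n => [|n IH] nd.
  have -> : tr 0%N = 0 by apply/rowP => i; rewrite !mxE.
  rewrite F0 normr0 [norm1 _]big1 ?expr0n ?mul0r ?mulr0 //.
  by move=> i _; rewrite mxE normr0.
pose i := Ordinal nd.
have trS : tr n.+1 = tr n + y ord0 i *: ebasis i.
  apply/rowP => j; rewrite !mxE eqxx /= ltnS leq_eqVlt.
  have [->|ji] := eqVneq j i; first by rewrite /= eqxx ltnn add0r mulr1.
  rewrite mulr0 addr0; case: eqP => // jn.
  by case/eqP: ji; exact: val_inj.
have trn1 t : norm1 (tr n + t *: ebasis i) = norm1 (tr n) + `|t|.
  rewrite /norm1 (bigD1 i) //= [X in _ = X + _](bigD1 i) //=.
  rewrite !mxE !eqxx /= ltnn add0r mulr1 normr0 add0r addrC; congr (_ + _).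
  by apply: eq_bigr => j ji; rewrite !mxE eqxx (negbTE ji) mulr0 addr0.
have box (t : R) : `|t| <= `|y ord0 i| -> in_box y (tr n + t *: ebasis i).
  move=> ti j; rewrite !mxE eqxx /=; have [->|ji] := eqVneq j i.
    by rewrite ltnn add0r mulr1.
  by rewrite mulr0 addr0; case: ifP; rewrite ?normr0.
have hd (t : R) : is_derive t 1 (fun t : R => F (tr n + t *: ebasis i))
    (dF i (tr n + t *: ebasis i)).
  have [D1 D2] := FdF i (tr n + t *: ebasis i).
  by rewrite -D2; exact: is_derive_line.
have step : `|F (tr n.+1) - F (tr n)| <= K * (norm1 (tr n.+1) ^+ m.+1 / m.+1`!%:R)
    - K * (norm1 (tr n) ^+ m.+1 / m.+1`!%:R).
  have := @growth_line R _ _ K (norm1 (tr n)) (y ord0 i) m hd.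
  rewrite -!trn1 -trS scale0r addr0; apply => t ti.
  by rewrite -trn1; apply: HK; exact: box.
have := IH (ltnW nd); have := ler_normD (F (tr n.+1) - F (tr n)) (F (tr n)).
rewrite subrK; lra.
Qed.

(** Induction on [m]: the partial derivatives of a remainder of order [m.+1] are remainders of order
    [m] of first derivatives, and [growth_box] integrates the bound because the remainder vanishes
    at 0. The hypothesis ranges over a box and over all sequences so that it passes to the first
    derivatives. *)
Lemma trem_bound m g y (K : R) : rsmooth g ->
  (forall z s, in_box y z -> size s = m -> `|foldr (@pderiv R d) g s z| <= K) ->
  `|trem m g y| <= K * (norm1 y ^+ m / m`!%:R).
Proof.
elim: m g y => [|m IH] g y sg H.
  by rewrite /trem tpoly0 subr0 fact0 expr0 divr1 mulr1; exact: (H _ [::]).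
apply: (@growth_box _ (fun i => trem m (pderiv i g))).
- exact: trem0.
- by move=> i z; exact: is_derive_trem.
- move=> i z yz; apply: IH; first exact: rsmooth_pderiv.
  move=> w s zw sm; have := H w (s ++ [:: i]); rewrite foldr_cat; apply.
    by move=> j; exact: le_trans (zw j) (yz j).
  by rewrite size_cat addn1 sm.
Qed.

End Taylor.

(** * Seminorm bounds without the associated function *)

Section Norms.
Variables (R : realType) (M N : nat -> R).
Hypotheses (M_pos : weight_seq M) (N_pos : weight_seq N).

(* Says [assoc_fun N t <= ln S], see [assoc_funP]; fails for every [S] where
   [assoc_fun N t = +oo], and [Kbound] then imposes nothing, in accordance with
   [expeR (- +oo) = 0]. *)
Definition weight_le (t S : R) := forall p, t ^+ p * N 0%N <= S * N p.

Lemma weight_le_ge1 t S : weight_le t S -> 1 <= S.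
Proof. by move=> /(_ 0%N); rewrite expr0 ler_pM2r. Qed.

Lemma weight_leS (t t' S : R) : 0 <= t' -> t' <= t -> weight_le t S ->
  weight_le t' S.
Proof.
move=> t0 tt wS p; apply: le_trans (wS p).
by rewrite ler_wpM2r ?(ltW (N_pos 0)) // lerXn2r // nnegrE // (le_trans t0).
Qed.

Lemma assoc_funP (t S : R) : 0 <= t -> 0 < S ->
  (assoc_fun N t <= lne S%:E)%E <-> weight_le t S.
Proof.
move=> t0 S0.
have E p : (lne (t ^+ p * N 0%N / N p)%:E <= lne S%:E)%E =
           (t ^+ p * N 0%N <= S * N p).
  rewrite lee_lne ?in_itv /= ?lee_fin ?(ltW S0) ?leey //.
    by rewrite ler_pdivrMr.
  by rewrite ?andbT ?lee_fin divr_ge0 ?mulr_ge0 ?exprn_ge0 ?(ltW (N_pos _)).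
split=> [H p|H]; last by apply: ub_ereal_sup => _ [p _ <-]; rewrite E.
by rewrite -E; apply: le_trans H; apply: ereal_sup_ubound; exists p.
Qed.

Lemma assoc_fun_ge0 t : (0 <= assoc_fun N t)%E.
Proof.
apply: ereal_sup_ubound; exists 0%N => //.
by rewrite expr0 mul1r divff ?gt_eqF // lne1.
Qed.

Lemma enorm_ge0 d (x : 'rV[R]_d) : 0 <= enorm x.
Proof. exact: sqrtr_ge0. Qed.

Lemma cmod_ge0 (z : R[i]) : 0 <= cmod z.
Proof. by case: z => a b; exact: sqrtr_ge0. Qed.

Variable d : nat.
Implicit Types (phi psi : 'rV[R]_d -> R[i]) (l q C : R).

Definition Kbound l q C phi :=
  forall (a : multi_index d) (x : 'rV[R]_d) (S : R),
    weight_le (q * enorm x) S ->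
    (1 + enorm x) ^+ mi_order a * cmod (mderiv a phi x)
      <= C * S * (l ^+ mi_order a * M (mi_order a)).

(** Where the associated function is finite, its exponential is the least admissible [S]; where it
    is infinite, the term of [Knorm] is 0 and there is nothing to check. *)
Lemma Knorm_leP l q C phi : 0 < l -> 0 <= q -> 0 <= C ->
  (Knorm M N l q phi <= C%:E)%E <-> Kbound l q C phi.
Proof.
move=> l0 q0 C0; split=> [H a x S wS|H].
  have S0 : 0 < S by rewrite (lt_le_trans _ (weight_le_ge1 wS)).
  have lM : 0 < l ^+ mi_order a * M (mi_order a) by rewrite mulr_gt0 ?exprn_gt0.
  rewrite -ler_pdivrMr // [C * S]mulrC -ler_pdivrMl //.
  rewrite -lee_fin; apply: le_trans H.
  apply: le_trans; last first.
    by apply: ereal_sup_ubound; exists a => //; reflexivity.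
  apply: le_trans; last first.
    by apply: ereal_sup_ubound; exists x => //; reflexivity.
  rewrite EFinM lee_wpmul2r //.
    rewrite lee_fin divr_ge0 ?(ltW lM) // mulr_ge0 ?cmod_ge0 //.
    by rewrite exprn_ge0 // addr_ge0 ?enorm_ge0.
  have -> : (S^-1)%:E = expeR (- lne S%:E).
    by rewrite lne_EFin // -EFinN /= expRN lnK // posrE.
  by rewrite lee_expeR leeN2 assoc_funP // mulr_ge0 // enorm_ge0.
apply: ub_ereal_sup => _ [a _ <-]; apply: ub_ereal_sup => _ [x _ <-].
have lM : 0 < l ^+ mi_order a * M (mi_order a) by rewrite mulr_gt0 ?exprn_gt0.
have qx : 0 <= q * enorm x by rewrite mulr_ge0 // enorm_ge0.
case E : (assoc_fun N (q * enorm x)) (assoc_fun_ge0 (q * enorm x)) => [r| |] // _;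
  last by rewrite /= mul0e lee_fin.
have er := expR_gt0 r.
have wS : weight_le (q * enorm x) (expR r).
  by rewrite -assoc_funP // E lne_EFin // expRK.
have := H a x _ wS.
rewrite /= -EFinM lee_fin expRN => H'.
by rewrite mulrC ler_pdivrMr // ler_pdivrMr // (le_trans H') // mulrAC.
Qed.

End Norms.

(** * Linear combinations and dilations *)

Section Operations.
Variables (R : realType) (d : nat).
Implicit Types (g u v : 'rV[R]_d -> R) (i : 'I_d) (x y : 'rV[R]_d)
  (phi psi : 'rV[R]_d -> R[i]) (a : multi_index d) (s : seq 'I_d).

Lemma foldr_pderiv_lin u v (p q : R) s : rsmooth u -> rsmooth v ->
  foldr (@pderiv R d) (fun x => p * u x + q * v x) s =
  fun x => p * foldr (@pderiv R d) u s x + q * foldr (@pderiv R d) v s x.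
Proof.
move=> su sv; elim: s => //= i s ->; apply/funext => x.
have du := derivableP (rsmooth_derivable (i:=i) (x:=x) (rsmooth_foldr s su)).
have dv := derivableP (rsmooth_derivable (i:=i) (x:=x) (rsmooth_foldr s sv)).
by have [_] := is_deriveD (is_deriveZ p du) (is_deriveZ q dv).
Qed.

Lemma rsmooth_lin u v (p q : R) : rsmooth u -> rsmooth v ->
  rsmooth (fun x => p * u x + q * v x).
Proof.
move=> su sv s /=; rewrite foldr_pderiv_lin //.
have {}su := rsmooth_foldr s su; have {}sv := rsmooth_foldr s sv.
split=> [x|i x].
  have cu := cvgMl_tmp (a := p) (rsmooth_continuous su (x:=x)).
  have cv := cvgMl_tmp (a := q) (rsmooth_continuous sv (x:=x)).
  exact: (cvgD (cu (nbhs_filter x)) (cv (nbhs_filter x))).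
have du := derivableP (rsmooth_derivable (i:=i) (x:=x) su).
have dv := derivableP (rsmooth_derivable (i:=i) (x:=x) sv).
by have [] := is_deriveD (is_deriveZ p du) (is_deriveZ q dv).
Qed.

(** The real or imaginary part of a complex combination of two functions involves four real
    functions; the factors [1] bring it to a shape in which [foldr_pderiv_lin] applies at both
    levels. *)
Lemma foldr_pderiv_lin4 u1 u2 v1 v2 (p1 p2 q1 q2 : R) s :
  rsmooth u1 -> rsmooth u2 -> rsmooth v1 -> rsmooth v2 ->
  foldr (@pderiv R d) (fun x => 1 * (p1 * u1 x + p2 * u2 x) +
    1 * (q1 * v1 x + q2 * v2 x)) s =
  fun x => 1 * (p1 * foldr (@pderiv R d) u1 s x + p2 * foldr (@pderiv R d) u2 s x) +
    1 * (q1 * foldr (@pderiv R d) v1 s x + q2 * foldr (@pderiv R d) v2 s x).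
Proof.
move=> su1 su2 sv1 sv2.
rewrite (foldr_pderiv_lin 1 1 s (rsmooth_lin p1 p2 su1 su2) (rsmooth_lin q1 q2 sv1 sv2)).
by rewrite (foldr_pderiv_lin p1 p2 s su1 su2) (foldr_pderiv_lin q1 q2 s sv1 sv2).
Qed.

Lemma is_derive_dilation g (c : R) i x : derivable g (c *: x) (ebasis i) ->
  is_derive x (ebasis i) (fun y => g (c *: y)) (c * pderiv i g (c *: x)).
Proof.
move=> dg; apply: is_derive_of_line.
have -> : (fun t : R => g (c *: (x + t *: ebasis i))) =
    (fun r : R => g (c *: x + r *: ebasis i)) \o (fun t : R => c * t).
  by apply/funext => t /=; rewrite scalerDr scalerA.
have cx : c *: x + (c * 0) *: ebasis i = c *: x by rewrite mulr0 scale0r addr0.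
have dl : is_derive (c * 0) 1 (fun r : R => g (c *: x + r *: ebasis i))
    (pderiv i g (c *: x)).
  by rewrite -{2}cx; apply: is_derive_line; rewrite cx.
have dc : is_derive (0 : R) 1 (fun t : R => c * t) (c * 1).
  exact: is_deriveZ.
by have := is_derive1_comp dl dc; rewrite mulr1 mulrC.
Qed.

Lemma foldr_pderiv_dilation g (c : R) s : rsmooth g ->
  foldr (@pderiv R d) (fun y => g (c *: y)) s =
  fun y => c ^+ size s * foldr (@pderiv R d) g s (c *: y).
Proof.
move=> sg; elim: s => [|i s /= ->]; first by apply/funext => y; rewrite mul1r.
apply/funext => x.
have dg := is_derive_dilation (rsmooth_derivable (i:=i) (x:=c *: x) (rsmooth_foldr s sg)).
have [_] := is_deriveZ (c ^+ size s) dg.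
by move=> E; rewrite exprSr -mulrA; exact: E.
Qed.

Lemma rsmooth_dilation g (c : R) : rsmooth g -> rsmooth (fun y => g (c *: y)).
Proof.
move=> sg s /=; rewrite foldr_pderiv_dilation //.
have {}sg := rsmooth_foldr s sg; split=> [x|i x].
  have cg : {for x, continuous (foldr (@pderiv R d) g s \o (fun y => c *: y))}.
    by apply: continuous_comp; [exact: scaler_continuous|exact: rsmooth_continuous].
  exact: (cvgMl_tmp cg).
have dg := is_derive_dilation (rsmooth_derivable (i:=i) (x:=c *: x) sg).
by have [] := is_deriveZ (c ^+ size s) dg.
Qed.

Lemma Re_lin phi psi (al be : R[i]) :
  (fun x => complex.Re (al * phi x + be * psi x)) = fun x =>
  1 * (complex.Re al * complex.Re (phi x) + (- complex.Im al) * complex.Im (phi x)) +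
  1 * (complex.Re be * complex.Re (psi x) + (- complex.Im be) * complex.Im (psi x)).
Proof.
apply/funext => x; case: al be (phi x) (psi x) => [? ?] [? ?] [? ?] [? ?] /=.
ring.
Qed.

Lemma Im_lin phi psi (al be : R[i]) :
  (fun x => complex.Im (al * phi x + be * psi x)) = fun x =>
  1 * (complex.Re al * complex.Im (phi x) + complex.Im al * complex.Re (phi x)) +
  1 * (complex.Re be * complex.Im (psi x) + complex.Im be * complex.Re (psi x)).
Proof.
apply/funext => x; case: al be (phi x) (psi x) => [? ?] [? ?] [? ?] [? ?] /=.
ring.
Qed.

Lemma csmooth_lin phi psi (al be : R[i]) : csmooth phi -> csmooth psi ->
  csmooth (fun x => al * phi x + be * psi x).
Proof.
move=> [s1 s2] [t1 t2]; rewrite /csmooth Re_lin Im_lin.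
by split; apply: rsmooth_lin; apply: rsmooth_lin.
Qed.

Lemma mderiv_lin a phi psi (al be : R[i]) x : csmooth phi -> csmooth psi ->
  mderiv a (fun x => al * phi x + be * psi x) x =
  al * mderiv a phi x + be * mderiv a psi x.
Proof.
move=> [s1 s2] [t1 t2]; rewrite /mderiv !rmderivE.
rewrite Re_lin Im_lin (foldr_pderiv_lin4 _ _ _ _ _ s1 s2 t1 t2).
rewrite (foldr_pderiv_lin4 _ _ _ _ _ s2 s1 t2 t1).
by apply/eqP; rewrite eq_complex; case: al be => [? ?] [? ?] /=;
  apply/andP; split; apply/eqP; ring.
Qed.

End Operations.

(** * Continuity of functionals on the steps *)

Section Spaces.
Variables (R : realType) (d : nat) (M N : nat -> R).
Hypotheses (M_pos : weight_seq M) (N_pos : weight_seq N).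
Implicit Types (phi psi : 'rV[R]_d -> R[i]) (a : multi_index d) (c : ultra_class)
  (x y : 'rV[R]_d) (s : seq 'I_d).

(* The parameters [l] and [q] of the seminorm [Kseminorm c M N s t]. *)
Definition klen c (s t : R) := if c is Beurling then t else s.

Definition kexp c (s t : R) := if c is Beurling then s else t.

Lemma klen_gt0 c (s t : R) : 0 < s -> 0 < t -> 0 < klen c s t.
Proof. by case: c. Qed.

Lemma kexp_gt0 c (s t : R) : 0 < s -> 0 < t -> 0 < kexp c s t.
Proof. by case: c. Qed.

Lemma Kseminorm_leP c (s t C : R) phi : 0 < s -> 0 < t -> 0 <= C ->
  (Kseminorm c M N s t phi <= C%:E)%E <->
  Kbound M N (klen c s t) (kexp c s t) C phi.
Proof. by move=> s0 t0 C0; case: c => /=; apply: Knorm_leP => //; exact: ltW. Qed.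

Lemma Kbound_mono (l l' q q' C : R) phi : 0 <= C -> 0 <= l -> l <= l' ->
  0 <= q -> q <= q' -> Kbound M N l q C phi -> Kbound M N l' q' C phi.
Proof.
move=> C0 l0 ll q0 qq H a x S wS.
have wS' : weight_le N (q * enorm x) S.
  by apply: weight_leS wS => //; rewrite ?mulr_ge0 ?ler_wpM2r ?enorm_ge0.
apply: (le_trans (H a x S wS')); apply: ler_wpM2l.
  by rewrite mulr_ge0 // (le_trans _ (weight_le_ge1 N_pos wS)).
rewrite ler_wpM2r ?(ltW (M_pos _)) // lerXn2r // nnegrE //.
exact: le_trans ll.
Qed.

Lemma Kbound_lin (l q C1 C2 : R) phi psi (al be : R[i]) :
  csmooth phi -> csmooth psi ->
  Kbound M N l q C1 phi -> Kbound M N l q C2 psi ->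
  Kbound M N l q (cmod al * C1 + cmod be * C2)
    (fun x => al * phi x + be * psi x).
Proof.
move=> sp sq H1 H2 a x S wS; rewrite mderiv_lin //.
apply: (@le_trans _ _ (cmod al * ((1 + enorm x) ^+ mi_order a * cmod (mderiv a phi x))
   + cmod be * ((1 + enorm x) ^+ mi_order a * cmod (mderiv a psi x)))).
  rewrite mulrCA [X in _ <= _ + X]mulrCA -mulrDr -!Normc.normcM.
  rewrite ler_wpM2l ?le_normcD // exprn_ge0 // addr_ge0 ?enorm_ge0 //.
rewrite !mulrDl lerD // -!mulrA ler_wpM2l ?cmod_ge0 //; rewrite !mulrA in H1 H2 *.
  by have := H1 a x S wS; rewrite !mulrA.
by have := H2 a x S wS; rewrite !mulrA.
Qed.

Lemma KstepP c (s : R) phi : 0 < s ->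
  @Kstep R d c M N s phi <-> csmooth phi /\ forall t : R, 0 < t ->
    exists2 C : R, 0 <= C & Kbound M N (klen c s t) (kexp c s t) C phi.
Proof.
move=> s0; split=> -[sp H]; split => // t t0; last first.
  have [C C0 HC] := H t t0.
  by apply: le_lt_trans (ltry C); apply/Kseminorm_leP.
set m := Num.max 0 (fine (Kseminorm c M N s t phi)).
have m0 : 0 <= m by rewrite le_max lexx.
exists m => //; apply/Kseminorm_leP => //.
have := H t t0; rewrite /m; case: (Kseminorm _ _ _ _ _ _) => [r| |] //= _.
  by rewrite lee_fin le_max lexx orbT.
by rewrite leNye.
Qed.

Lemma Kstep_lin c (s : R) phi psi (al be : R[i]) : 0 < s ->
  @Kstep R d c M N s phi -> @Kstep R d c M N s psi ->
  @Kstep R d c M N s (fun x => al * phi x + be * psi x).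
Proof.
move=> s0 /(KstepP _ _ s0)[sp Hp] /(KstepP _ _ s0)[sq Hq].
apply/(KstepP _ _ s0); split=> [|t t0]; first exact: csmooth_lin.
have [C1 C10 H1] := Hp t t0; have [C2 C20 H2] := Hq t t0.
exists (cmod al * C1 + cmod be * C2); last exact: Kbound_lin.
by rewrite addr_ge0 // mulr_ge0 // cmod_ge0.
Qed.

Lemma cmod_real (r : R) : cmod (real_complex R r) = `|r|.
Proof. by rewrite /= expr0n addr0 sqrtr_sqr. Qed.

(** Restricted to a step, continuity means control by finitely many seminorms, hence by a single
    one, since they increase as [t] decreases; homogeneity turns this into a linear bound. *)
Lemma Kdual_bound c f (s : R) : @Kdual R d c M N f -> 0 < s ->
  exists t B : R, [/\ 0 < t, 0 < B & forall psi (C : R), 0 < C ->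
    @Kstep R d c M N s psi -> Kbound M N (klen c s t) (kexp c s t) C psi ->
    cmod (f psi) <= B * C].
Proof.
move=> [flin fcont] s0.
have [V [VU _ _ /(_ s s0)[ts [e [ts0 e0 Ve]]]]] := fcont 1 ltr01.
have [t t0 tts] : exists2 t : R, 0 < t & forall u, u \in ts -> t <= u.
  elim: ts ts0 {Ve} => [|u ts IH] ts0; first by exists 1.
  have [|t t0 tts] := IH; first by move=> v vts; apply: ts0; rewrite in_cons vts orbT.
  have u0 : 0 < u by rewrite ts0 // mem_head.
  exists (Num.min t u); first by rewrite lt_min t0.
  move=> v; rewrite in_cons => /predU1P[->|/tts tv]; first by rewrite ge_min lexx orbT.
  by rewrite ge_min tv.
exists t, (2 / e); split => //; first by rewrite divr_gt0.
move=> psi C C0 Kpsi HC.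
(* The scaling brings the seminorm to at most [e / 2], which makes the strict inequality [< e]
   available. *)
pose al := real_complex R (e / (2 * C)).
pose chi x : R[i] := al * psi x + 0 * psi x.
have Kp : @Kspace R d c M N psi by exists s.
have e2C : 0 < e / (2 * C) by rewrite divr_gt0 ?mulr_gt0.
have Kchi : @Kstep R d c M N s chi by exact: Kstep_lin.
have /Ve[/VU[_ Hf] _] : [set phi | @Kstep R d c M N s phi /\
    forall u, u \in ts -> (Kseminorm c M N s u phi < e%:E)%E] chi.
  split=> // u uts.
  have [sp _] := (KstepP _ _ s0).1 Kpsi.
  have Hchi := Kbound_lin al 0 sp sp HC HC.
  apply: (@le_lt_trans _ _ (e / 2)%:E); last first.
    by rewrite lte_fin ltr_pdivrMr // ltr_pMr // ltr1n.
  apply/Kseminorm_leP => //; [exact: ts0|by rewrite divr_ge0 // ltW|].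
  have -> : e / 2 = cmod al * C + cmod 0 * C.
    rewrite cmod_real Normc.normc0 mul0r addr0 gtr0_norm //; field.
    by rewrite gt_eqF.
  apply: Kbound_mono Hchi; rewrite ?addr_ge0 ?mulr_ge0 ?cmod_ge0 ?(ltW C0) //.
  - exact/ltW/klen_gt0.
  - by case: (c) => //=; exact: tts.
  - exact/ltW/kexp_gt0.
  - by case: (c) => //=; exact: tts.
move: Hf; rewrite /chi flin // mul0r addr0 Normc.normcM cmod_real gtr0_norm //.
rewrite -ltr_pdivlMl // => /ltW H; apply: le_trans H _.
by rewrite mulr1 invf_div mulrAC.
Qed.

End Spaces.

(** * Monomials *)

Section Monomials.
Variables (R : realType) (d : nat).
Implicit Types (a b : multi_index d) (x y : 'rV[R]_d) (s : seq 'I_d)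
  (g : 'rV[R]_d -> R).

Lemma coord_le_enorm x i : `|x ord0 i| <= enorm x.
Proof.
rewrite -sqrtr_sqr ler_wsqrtr // (bigD1 i) //= lerDl sumr_ge0 // => j _.
exact: sqr_ge0.
Qed.

Lemma enorm_box x y : in_box x y -> enorm y <= enorm x.
Proof.
move=> H; rewrite ler_wsqrtr // ler_sum // => i _.
by rewrite -(real_normK (num_real (y _ _))) -(real_normK (num_real (x _ _))) lerXn2r ?nnegrE.
Qed.

Lemma enormZ (c : R) x : 0 <= c -> enorm (c *: x) = c * enorm x.
Proof.
move=> c0; rewrite /enorm; under eq_bigr do rewrite mxE exprMn.
by rewrite -mulr_sumr sqrtrM ?sqr_ge0 // sqrtr_sqr ger0_norm.
Qed.

Lemma norm1_le x : norm1 x <= d%:R * enorm x.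
Proof.
rewrite /norm1; apply: (@le_trans _ _ (\sum_(i < d) enorm x)).
  by apply: ler_sum => i _; exact: coord_le_enorm.
by rewrite sumr_const card_ord mulr_natl.
Qed.

Lemma norm1_ge0 x : 0 <= norm1 x.
Proof. by rewrite sumr_ge0. Qed.

Lemma norm1Z (c : R) x : 0 <= c -> norm1 (c *: x) = c * norm1 x.
Proof.
move=> c0; rewrite /norm1 mulr_sumr; apply: eq_bigr => i _.
by rewrite mxE normrM ger0_norm.
Qed.

Lemma emonom_le a x : `|emonom a x| <= (1 + enorm x) ^+ mi_order a.
Proof.
rewrite /emonom normr_prod /mi_order -prodrXr; apply: ler_prod => i _.
rewrite normr_ge0 normrM normrX normfV normr_nat /=.
rewrite ler_pdivrMr ?ltr0n ?fact_gt0 //.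
have xi : `|x ord0 i| ^+ a i <= (1 + enorm x) ^+ a i.
  rewrite lerXn2r ?nnegrE ?addr_ge0 ?enorm_ge0 //.
  by have := coord_le_enorm x i; lra.
apply: (le_trans xi); rewrite ler_peMr ?ler1n ?fact_gt0 // exprn_ge0 //.
by rewrite addr_ge0 ?enorm_ge0.
Qed.

Lemma foldr_pderiv_emonom a s :
  foldr (@pderiv R d) (emonom a) s = cst 0 \/
  exists2 b, mi_order a = (mi_order b + size s)%N &
    foldr (@pderiv R d) (emonom a) s = emonom b.
Proof.
elim: s => [|i s IH] /=; first by right; exists a; rewrite ?addn0.
case: IH => [->|[b ab ->]].
  by left; apply/funext => x; exact: derive_cst.
have [bi|bi] := eqVneq (b i) 0%N.
  left; apply/funext => x.
  by have [_] := is_derive_emonom i b x; rewrite bi eqxx.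
right; exists (mi_pred i b); first by rewrite ab (mi_order_pred bi) addSnnS.
apply/funext => x.
by have [_] := is_derive_emonom i b x; rewrite (negbTE bi).
Qed.

Lemma foldr_pderiv_cst0 s : foldr (@pderiv R d) (cst 0) s = cst 0.
Proof.
by elim: s => //= i s ->; apply/funext => x; exact: derive_cst.
Qed.

Lemma rsmooth_cst0 : rsmooth (cst 0 : 'rV[R]_d -> R).
Proof.
move=> s /=; rewrite foldr_pderiv_cst0.
by split=> [|i x]; [exact: cst_continuous|exact: derivable_cst].
Qed.

Lemma rsmooth_emonom a : rsmooth (emonom a : 'rV[R]_d -> R).
Proof.
move=> s /=; have [->|[b _ ->]] := foldr_pderiv_emonom a s.
  exact: (rsmooth_cst0 [::]).
split=> [|i x]; first exact: continuous_emonom.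
by have [] := is_derive_emonom i b x.
Qed.

Lemma tpoly_dilation k g (c : R) x :
  tpoly k g (c *: x) = \sum_(a <- mis d k) rmderiv a g 0 * c ^+ mi_order a * emonom a x.
Proof.
rewrite /tpoly; apply: eq_bigr => a _; rewrite -mulrA; congr (_ * _).
rewrite /emonom /mi_order -prodrXr -big_split; apply: eq_bigr => i _ /=.
by rewrite mxE exprMn mulrA.
Qed.

Definition cmonom a x : R[i] := real_complex R (emonom a x).

Lemma csmooth_cmonom a : csmooth (cmonom a).
Proof. by split; [exact: rsmooth_emonom|exact: rsmooth_cst0]. Qed.

Lemma mderiv_cmonom a b x :
  mderiv b (cmonom a) x = real_complex R (rmderiv b (emonom a) x).
Proof.
rewrite /mderiv; congr Complex; rewrite rmderivE.
exact: (congr1 (fun h => h x) (foldr_pderiv_cst0 (mi_seq b))).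
Qed.

End Monomials.

(** * Polynomials dominated by the weight *)

Section Weights.
Variables (R : realType) (d : nat) (M N : nat -> R).
Hypotheses (M_pos : weight_seq M) (N_pos : weight_seq N).

(** From [(1 + r)^n <= 2^n max(1, r^n)]: the inequality [weight_le] at the single exponent [n]
    bounds [r^n], and [1 <= S] bounds the rest. This is the source of [N_k] in [A_seq]. *)
Lemma weight_le_poly (q r S : R) n : 0 < q -> 0 <= r -> weight_le N (q * r) S ->
  (1 + r) ^+ n <= 2 ^+ n * (1 + N n / (N 0%N * q ^+ n)) * S.
Proof.
move=> q0 r0 wS; have S1 := weight_le_ge1 N_pos wS.
rewrite -mulrA mulrDl mul1r.
have rn : r ^+ n <= N n / (N 0%N * q ^+ n) * S.
  rewrite mulrAC ler_pdivlMr ?mulr_gt0 ?exprn_gt0 //.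
  by have := wS n; rewrite exprMn; lra.
have rn0 : 0 <= r ^+ n by rewrite exprn_ge0.
have q2 : 0 <= 2 ^+ n :> R by rewrite exprn_ge0.
have [r1|r1] := leP r 1.
  apply: (@le_trans _ _ (2 ^+ n)).
    by rewrite lerXn2r ?nnegrE //; lra.
  by rewrite ler_peMr //; lra.
apply: (@le_trans _ _ (2 ^+ n * r ^+ n)).
  by rewrite -exprMn lerXn2r ?nnegrE //; lra.
by rewrite ler_wpM2l //; lra.
Qed.

Lemma Kstep_cmonom c (s : R) (a : multi_index d) : 0 < s ->
  Kstep c M N s (cmonom a : 'rV[R]_d -> R[i]).
Proof.
move=> s0; apply/(KstepP M_pos N_pos _ _ s0).
split=> [|t t0]; first exact: csmooth_cmonom.
have l0 := klen_gt0 c s0 t0; have q0 := kexp_gt0 c s0 t0.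
move: (klen _ _ _) (kexp _ _ _) l0 q0 => l q l0 q0.
set n := mi_order a.
pose E := 2 ^+ n * (1 + N n / (N 0%N * q ^+ n)).
have E0 : 0 <= E.
  by rewrite mulr_ge0 ?exprn_ge0 // addr_ge0 // divr_ge0 ?mulr_ge0 ?exprn_ge0 // ltW.
have lM j : 0 < l ^+ j * M j by rewrite mulr_gt0 // exprn_gt0.
(* Derivatives of order above [n] vanish, so finitely many orders matter; the sum dominates the
   constant required by each of them. *)
exists (\sum_(j < n.+1) E / (l ^+ j * M j)).
  by rewrite sumr_ge0 // => j _; rewrite divr_ge0 // ltW.
move=> b x S wS; have S1 := weight_le_ge1 N_pos wS.
rewrite mderiv_cmonom cmod_real rmderivE.
have [->|[b' ab ->]] := foldr_pderiv_emonom R a (mi_seq b).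
  rewrite normr0 mulr0 mulr_ge0 ?(ltW (lM _)) // mulr_ge0 //; last lra.
  by rewrite sumr_ge0 // => j _; rewrite divr_ge0 // ltW.
rewrite size_mi_seq in ab.
apply: (@le_trans _ _ ((1 + enorm x) ^+ n)).
  rewrite /n ab addnC exprD ler_wpM2l ?emonom_le // exprn_ge0 //.
  by rewrite addr_ge0 // enorm_ge0.
apply: (le_trans (weight_le_poly n q0 (enorm_ge0 x) wS)); rewrite -/E.
have bn : (mi_order b < n.+1)%N by rewrite ltnS /n ab leq_addl.
rewrite [leRHS]mulrAC ler_wpM2r //; first lra.
rewrite -ler_pdivrMr // (bigD1 (Ordinal bn)) //= lerDl sumr_ge0 // => j _.
by rewrite divr_ge0 // ltW.
Qed.

End Weights.

(** * Estimates of the dilated remainder *)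

Section ComplexParts.
Variable R : realType.

Lemma cmod_le (u v : R) : cmod (Complex u v) <= `|u| + `|v|.
Proof.
have uv : 0 <= `|u| + `|v| by rewrite addr_ge0.
rewrite /= -(ger0_norm uv) -sqrtr_sqr ler_wsqrtr //.
rewrite sqrrD !real_normK ?num_real // -addrA lerD2l lerDr.
by rewrite mulrn_wge0 // mulr_ge0.
Qed.

Lemma Re_le_cmod (z : R[i]) : `|complex.Re z| <= cmod z.
Proof. by case: z => u v; rewrite -sqrtr_sqr ler_wsqrtr // lerDl sqr_ge0. Qed.

Lemma Im_le_cmod (z : R[i]) : `|complex.Im z| <= cmod z.
Proof. by case: z => u v; rewrite -sqrtr_sqr ler_wsqrtr // lerDr sqr_ge0. Qed.

End ComplexParts.

(** * Consequences of (M.2) and of the root condition *)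

Section WeightConditions.
Variable R : realType.

Lemma cond_M2_ge1 (M : nat -> R) : weight_seq M -> cond_M2 M ->
  exists A H : R, [/\ 1 <= A, 1 <= H & forall p q : nat,
    M (p + q)%N <= A * H ^+ (p + q) * M p * M q].
Proof.
move=> M_pos [A [H AH]]; exists (1 + `|A|), (1 + `|H|).
split; [by rewrite lerDl..|move=> p q; apply: le_trans (AH p q) _].
rewrite !ler_wpM2r ?(ltW (M_pos _)) //.
apply: le_trans (ler_norm _) _; rewrite normrM normrX.
by rewrite ler_pM ?exprn_ge0 ?lerXn2r ?nnegrE ?addr_ge0 // lerDr.
Qed.

(** The infimum [c] gives [c^k <= N k] for positive [k] only; the summand [(N 0)^-1] in the constant
    takes care of [k = 0]. *)
Lemma root_lower_bound (N : nat -> R) : weight_seq N ->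
  0 < inf [set N p `^ (p%:R^-1) | p in [set p : nat | (0 < p)%N]] ->
  exists C D : R, [/\ 1 <= C, 1 <= D & forall k, 1 <= C * D ^+ k * N k].
Proof.
set X := [set _ | _ in _] => N_pos; set c := inf X => c0.
have X0 : has_lbound X by exists 0 => _ [p _ <-]; exact: powR_ge0.
have N0 := N_pos 0%N.
exists (1 + (N 0%N)^-1), (1 + c^-1).
split; rewrite ?lerDl ?invr_ge0 ?ltW // => -[|k].
  by rewrite expr0 mulr1 mulrDl mul1r mulVf ?gt_eqF // lerDr ltW.
have ck : c ^+ k.+1 <= N k.+1.
  have cX : c <= N k.+1 `^ k.+1%:R^-1 by apply: ge_inf => //; exists k.+1.
  have -> : N k.+1 = (N k.+1 `^ k.+1%:R^-1) ^+ k.+1.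
    by rewrite -powR_mulrn ?powR_ge0 // -powRrM mulVf ?pnatr_eq0 // powRr1 // ltW.
  by rewrite lerXn2r // nnegrE ?powR_ge0 // ltW.
have ci : 0 <= c^-1 by rewrite invr_ge0 ltW.
have ck0 : 0 < c ^+ k.+1 by rewrite exprn_gt0.
apply: (@le_trans _ _ ((c ^+ k.+1)^-1 * N k.+1)).
  by rewrite ler_pdivlMl // mulr1.
rewrite ler_wpM2r ?(ltW (N_pos _)) // -exprVn.
apply: (@le_trans _ _ ((1 + c^-1) ^+ k.+1)).
  by rewrite lerXn2r ?nnegrE ?addr_ge0 // lerDr.
by rewrite ler_peMl ?exprn_ge0 ?addr_ge0 // lerDl invr_ge0 ltW.
Qed.

(* The form taken by [2 N(t) <= N(H t) + const]. *)
Lemma weight_le_sqrt (N : nat -> R) (A H t S : R) : weight_seq N -> 1 <= A -> 1 <= H ->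
  (forall p q : nat, N (p + q)%N <= A * H ^+ (p + q) * N p * N q) ->
  0 <= t -> weight_le N (H * t) S -> weight_le N t (Num.sqrt (S * A * N 0%N)).
Proof.
move=> N_pos A1 H1 N_M2 t0 wS p.
have S1 := weight_le_ge1 N_pos wS.
have N0 := N_pos 0%N; have Np := N_pos p.
have SA : 0 <= S * A * N 0%N by rewrite !mulr_ge0 // ?(ltW N0) //; lra.
rewrite -[leLHS]ger0_norm ?mulr_ge0 ?exprn_ge0 ?(ltW N0) // -sqrtr_sqr.
rewrite -[X in _ <= _ * X]gtr0_norm // -sqrtr_sqr -sqrtrM // ler_wsqrtr //.
have Hp : 0 < H ^+ (p + p) by rewrite exprn_gt0 //; lra.
(* The hypothesis on [S] at exponent [p + p], then (M.2) with both indices equal to [p]; the factor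
   [H ^+ (p + p)] cancels against the dilated argument [H * t]. *)
have E : t ^+ (p + p) * N 0%N <= S * A * N p * N p.
  rewrite -(ler_pM2l Hp) mulrA -exprMn; apply: le_trans (wS _) _.
  rewrite [leRHS](_ : _ = S * (A * H ^+ (p + p) * N p * N p)); last by ring.
  by rewrite ler_wpM2l //; lra.
rewrite exprMn -exprM muln2 -addnn expr2 mulrA.
rewrite [leRHS](_ : _ = S * A * N p * N p * N 0%N); last by ring.
by rewrite ler_wpM2r // ltW.
Qed.

End WeightConditions.

Section Remainder.
Variables (R : realType) (d : nat).
Implicit Types (phi : 'rV[R]_d -> R[i]) (a : multi_index d) (x y z : 'rV[R]_d).

Definition crem k (lam : R) phi x : R[i] :=
  Complex (trem k (fun y => complex.Re (phi y)) (lam^-1 *: x))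
          (trem k (fun y => complex.Im (phi y)) (lam^-1 *: x)).

Lemma csmooth_crem k lam phi : csmooth phi -> csmooth (crem k lam phi).
Proof. by move=> [s1 s2]; split; apply: rsmooth_dilation; exact: rsmooth_trem. Qed.

Lemma mderiv_crem k lam phi a x : csmooth phi ->
  mderiv a (crem k lam phi) x =
  Complex (lam^-1 ^+ mi_order a * trem (k - mi_order a)
             (rmderiv a (fun y => complex.Re (phi y))) (lam^-1 *: x))
          (lam^-1 ^+ mi_order a * trem (k - mi_order a)
             (rmderiv a (fun y => complex.Im (phi y))) (lam^-1 *: x)).
Proof.
move=> [s1 s2]; rewrite /mderiv !rmderivE -!size_mi_seq /crem /=.
rewrite (foldr_pderiv_dilation _ _ (rsmooth_trem k s1)).
rewrite (foldr_pderiv_dilation _ _ (rsmooth_trem k s2)).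
by rewrite !foldr_pderiv_trem.
Qed.

Variables (M N : nat -> R).
Hypotheses (M_pos : weight_seq M) (N_pos : weight_seq N).

Lemma Kbound_deriv l q (C T : R) phi x z a : 0 <= C -> 0 <= l -> 0 <= q ->
  Kbound M N l q C phi -> enorm z <= enorm x -> weight_le N (q * enorm x) T ->
  (1 + enorm z) ^+ mi_order a * cmod (mderiv a phi z)
    <= C * T * (l ^+ mi_order a * M (mi_order a)).
Proof.
move=> C0 l0 q0 H zx wT; apply: H; apply: weight_leS wT => //.
  by rewrite mulr_ge0 // enorm_ge0.
by rewrite ler_wpM2l.
Qed.

(** Only derivatives of [phi] of order exactly [k] on the box of [y] are involved. Their factor
    [(1 + |z|)^k] is bounded below by 1, and the weight is taken at [x], which dominates all points
    of the box. *)
Lemma Kbound_trem l q (C T : R) phi x y a k : csmooth phi ->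
  0 <= C -> 0 <= l -> 0 <= q ->
  Kbound M N l q C phi -> enorm y <= enorm x -> weight_le N (q * enorm x) T ->
  (mi_order a <= k)%N ->
  let m := (k - mi_order a)%N in
  let K := C * T * (l ^+ k * M k) * (norm1 y ^+ m / m`!%:R) in
  `|trem m (rmderiv a (fun y => complex.Re (phi y))) y| <= K /\
  `|trem m (rmderiv a (fun y => complex.Im (phi y))) y| <= K.
Proof.
move=> [s1 s2] C0 l0 q0 H yx wT ak m K.
have D z s : in_box y z -> size s = m ->
    cmod (mderiv (mi_of (s ++ mi_seq a)) phi z) <= C * T * (l ^+ k * M k).
  move=> yz sm; have zx : enorm z <= enorm x := le_trans (enorm_box yz) yx.
  have := Kbound_deriv (mi_of (s ++ mi_seq a)) C0 l0 q0 H zx wT.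
  rewrite mi_order_mi_of size_cat size_mi_seq sm /m subnK //.
  apply: le_trans; rewrite ler_peMl ?cmod_ge0 // exprn_ege1 //.
  by rewrite lerDl enorm_ge0.
split; apply: trem_bound; rewrite ?rmderivE; do ?exact: rsmooth_foldr.
- move=> z s yz sm; rewrite -foldr_cat foldr_pderivE //.
  by apply: le_trans (D z s yz sm); exact: (Re_le_cmod (mderiv _ phi z)).
- move=> z s yz sm; rewrite -foldr_cat foldr_pderivE //.
  by apply: le_trans (D z s yz sm); exact: (Im_le_cmod (mderiv _ phi z)).
Qed.

End Remainder.

Section MainEstimate.
Variables (R : realType) (d : nat) (M N : nat -> R).
Hypotheses (M_pos : weight_seq M) (N_pos : weight_seq N).
Variables (AM HM AN HN C0 D0 : R).
Hypotheses (AM1 : 1 <= AM) (HM1 : 1 <= HM) (AN1 : 1 <= AN) (HN1 : 1 <= HN)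
  (C01 : 1 <= C0) (D01 : 1 <= D0)
  (M_M2 : forall p q : nat, M (p + q)%N <= AM * HM ^+ (p + q) * M p * M q)
  (N_M2 : forall p q : nat, N (p + q)%N <= AN * HN ^+ (p + q) * N p * N q)
  (N_low : forall k, 1 <= C0 * D0 ^+ k * N k).

Let AM0 : 0 <= AM. Proof. exact: le_trans AM1. Qed.
Let HM0 : 0 <= HM. Proof. exact: le_trans HM1. Qed.
Let AN0 : 0 <= AN. Proof. exact: le_trans AN1. Qed.

Local Notation mmax k := (\big[Num.max/0]_(j < k.+1) (M j / (j`!)%:R)).

Lemma mmax_ge k m : (m <= k)%N -> M m / (m`!)%:R <= mmax k.
Proof.
rewrite -ltnS => mk; apply: (le_bigmax_cond 0 (fun j : 'I_k.+1 => M j / (j`!)%:R)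
  (isT : xpredT (Ordinal mk))).
Qed.

Lemma M0_ge : 1 <= AM * M 0.
Proof.
have := M_M2 0 0; rewrite addn0 expr0 mulr1.
by rewrite -[leLHS]mul1r ler_pM2r.
Qed.

Lemma mmax_ge0 k : 0 <= mmax k.
Proof. by apply: le_trans (mmax_ge (leq0n k)); rewrite divr_ge0 // ltW. Qed.

Lemma A_seq_gt0 k : 0 < A_seq M N k.
Proof.
rewrite mulr_gt0 //; apply: lt_le_trans (mmax_ge (leq0n k)).
by rewrite divr_gt0.
Qed.

(** [T] is the square root supplied by [weight_le_sqrt]. One factor [T] comes from the growth of
    [phi], the other from bounding [(1 + r)^k], and together they restore a multiple of [S]. *)
Lemma poly_weight (q r S T : R) k : 0 < q -> 0 <= r -> weight_le N (q * r) T ->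
  T ^+ 2 = S * AN * N 0%N ->
  (1 + r) ^+ k * T <=
    2 ^+ k * ((C0 + (N 0%N)^-1) * (D0 + q^-1) ^+ k * N k) * (S * AN * N 0%N).
Proof.
move=> q0 r0 wT TS; have T1 := weight_le_ge1 N_pos wT.
have N0 := N_pos 0%N; have Nk := N_pos k.
have := weight_le_poly N_pos k q0 r0 wT => H.
rewrite -TS expr2 mulrA ler_wpM2r //; first lra.
apply: (le_trans H); rewrite ler_wpM2r //; first lra.
rewrite ler_wpM2l ?exprn_ge0 // !mulrDl.
have qi : 0 <= q^-1 by rewrite invr_ge0 ltW.
have C00 : 0 <= C0 by rewrite (le_trans _ C01).
have D00 : 0 <= D0 by rewrite (le_trans _ D01).
have Dq : 0 <= D0 + q^-1 by rewrite addr_ge0.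
apply: lerD.
  apply: le_trans (N_low k) _; rewrite ler_wpM2r ?(ltW Nk) //.
  by rewrite ler_wpM2l ?lerXn2r ?nnegrE ?lerDl.
rewrite invfM mulrC -exprVn ler_wpM2r ?(ltW Nk) // ler_wpM2l ?invr_ge0 ?(ltW N0) //.
by rewrite lerXn2r ?nnegrE ?lerDr.
Qed.

(** In [est_B], the 2 accounts for real and imaginary parts, [AN * N 0] for [T ^+ 2], and [AM] for
    (M.2) of [M]. In [est_D], [d + 1] comes from [norm1 <= d |x|], the 2 and [D0 + q^-1] from
    [poly_weight], and [HM] from (M.2) of [M]. *)
Definition est_B : R := 2 * AN * N 0%N * AM.
Definition est_D (q : R) : R := (d%:R + 1) * 2 * (D0 + q^-1) * HM.

Lemma estimate_low (q r S T lam l l' C nr : R) k b m : (b + m = k)%N ->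
  0 < q -> 0 <= r -> weight_le N (q * r) T -> 1 <= S ->
  T ^+ 2 = S * AN * N 0%N ->
  1 <= lam -> 0 < l -> 0 < l' -> 0 <= C -> 0 <= nr -> nr <= d%:R * r ->
  (1 + r) ^+ b * (2 * (lam^-1 ^+ b * (C * T * (l ^+ k * M k) *
     ((lam^-1 * nr) ^+ m / m`!%:R)))) <=
  C * (est_B * (C0 + (N 0%N)^-1)) *
    ((est_D q * l * (1 + l'^-1)) ^+ k * A_seq M N k / lam ^+ k) * S *
    (l' ^+ b * M b).
Proof.
move=> bmk q0 r0 wT S1 TS lam1 l0 l'0 C00 nr0 nrd.
have T1 := weight_le_ge1 N_pos wT.
have N0 := N_pos 0%N; have Nk := N_pos k.
have lam0 : 0 < lam by lra.
have Mm : 0 <= M m / m`!%:R by rewrite divr_ge0 // ltW.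
have Mk : M k / m`!%:R <= AM * HM ^+ k * M b * mmax k.
  apply: (@le_trans _ _ (AM * HM ^+ k * M b * (M m / m`!%:R))).
    rewrite mulrA ler_wpM2r ?invr_ge0 //; by rewrite -bmk.
  rewrite ler_wpM2l ?mmax_ge -?bmk ?leq_addl //.
  by rewrite !mulr_ge0 ?exprn_ge0 ?(ltW (M_pos _)).
have P1 := poly_weight k q0 r0 wT TS.
set P := (X in _ <= X) in P1.
have d0 : 0 <= d%:R :> R by [].
have r1 : 0 <= 1 + r by lra.
have P2 : (1 + r) ^+ b * nr ^+ m * T <= (d%:R + 1) ^+ k * P.
  apply: (@le_trans _ _ ((d%:R + 1) ^+ k * ((1 + r) ^+ k * T))); last first.
    by rewrite ler_wpM2l ?exprn_ge0 //; lra.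
  rewrite mulrA ler_wpM2r //; first lra.
  rewrite -[in leRHS]bmk [in X in _ <= _ * X]exprD mulrCA ler_wpM2l ?exprn_ge0 //.
  apply: (@le_trans _ _ (((d%:R + 1) * (1 + r)) ^+ m)).
    by rewrite lerXn2r ?nnegrE //; nra.
  rewrite exprMn ler_wpM2r ?exprn_ge0 // exprD ler_peMl ?exprn_ge0 ?exprn_ege1 //; lra.
(* The target contains [l' ^+ b] and the left side does not; inserting it costs a factor that is
   uniform over all [b <= k]. *)
have L1 : 1 <= l' ^+ b * (1 + l'^-1) ^+ k.
  have li : 0 <= l'^-1 by rewrite invr_ge0 ltW.
  apply: (@le_trans _ _ (l' ^+ b * (l'^-1) ^+ b)).
    by rewrite -exprMn mulfV ?gt_eqF // expr1n.
  rewrite ler_wpM2l ?exprn_ge0 ?(ltW l'0) //.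
  apply: (@le_trans _ _ ((1 + l'^-1) ^+ b)).
    by rewrite lerXn2r ?nnegrE //; lra.
  by rewrite -bmk exprD ler_peMr ?exprn_ge0 ?exprn_ege1 //; lra.
pose K0 := 2 * C * lam^-1 ^+ k * l ^+ k.
have K00 : 0 <= K0.
  by rewrite !mulr_ge0 ?exprn_ge0 ?invr_ge0 ?(ltW lam0) ?(ltW l0).
rewrite [leLHS](_ : _ = K0 * (M k / m`!%:R) * ((1 + r) ^+ b * nr ^+ m * T)); last first.
  by rewrite /K0 -[in lam^-1 ^+ k]bmk exprD exprMn; ring.
have nn1 : 0 <= (1 + r) ^+ b * nr ^+ m * T by rewrite !mulr_ge0 ?exprn_ge0 //; lra.
have nn2 : 0 <= AM * HM ^+ k * M b * mmax k.
  by rewrite !mulr_ge0 ?exprn_ge0 ?mmax_ge0 ?(ltW (M_pos _)).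
apply: (@le_trans _ _ (K0 * (AM * HM ^+ k * M b * mmax k) * ((d%:R + 1) ^+ k * P))).
  rewrite ler_pM //; last by rewrite ler_wpM2l.
  by rewrite mulr_ge0 // divr_ge0 // ltW.
have nn3 : 0 <= (d%:R + 1) ^+ k * P by apply: le_trans P2.
apply: (@le_trans _ _ (K0 * (AM * HM ^+ k * M b * mmax k) * ((d%:R + 1) ^+ k * P) *
   (l' ^+ b * (1 + l'^-1) ^+ k))).
  rewrite ler_peMr //.
  by apply: mulr_ge0 nn3; exact: mulr_ge0.
rewrite le_eqVlt; apply/orP; left; apply/eqP.
rewrite /K0 /P /est_B /est_D /A_seq -exprVn !exprMn; ring.
Qed.

(** As [lam >= 1], one has [(1 + r) / lam <= 1 + r / lam]. Hence [b - k] of the factors are absorbed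
    by the decay of the derivative at [x / lam]; the other [k] yield [lam^-k] and are paid for by
    the weight. *)
Lemma estimate_high (q r S T lam l l' C w : R) k b : (k <= b)%N ->
  0 < q -> 0 <= r -> weight_le N (q * r) T -> 1 <= S ->
  T ^+ 2 = S * AN * N 0%N ->
  1 <= lam -> 0 < l -> l <= l' -> 0 <= C -> 0 <= w ->
  (1 + lam^-1 * r) ^+ b * w <= C * T * (l ^+ b * M b) ->
  (1 + r) ^+ b * (lam^-1 ^+ b * w) <=
  C * (est_B * (C0 + (N 0%N)^-1)) *
    ((est_D q * l * (1 + l'^-1)) ^+ k * A_seq M N k / lam ^+ k) * S *
    (l' ^+ b * M b).
Proof.
move=> kb q0 r0 wT S1 TS lam1 l0 ll C00 w0 Hw.
have T1 := weight_le_ge1 N_pos wT.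
have N0 := N_pos 0%N; have Nk := N_pos k; have Mb := ltW (M_pos b).
have lam0 : 0 < lam by lra.
have l'0 : 0 < l' by lra.
have li : 0 < lam^-1 by rewrite invr_gt0.
have li1 : lam^-1 <= 1 by rewrite invf_le1.
have r1 : 0 <= 1 + r by lra.
have lr : 0 <= lam^-1 * r by rewrite mulr_ge0 // ltW.
have P1 := poly_weight k q0 r0 wT TS.
set P := (X in _ <= X) in P1.
have P0 : 0 <= P by apply: le_trans P1; rewrite mulr_ge0 ?exprn_ge0 //; lra.
have [j bk] : exists j, b = (k + j)%N by exists (b - k)%N; rewrite subnKC.
have H1 : (1 + r) ^+ b * lam^-1 ^+ b <=
    (1 + r) ^+ k * lam^-1 ^+ k * (1 + lam^-1 * r) ^+ b.
  rewrite -!exprMn {1}bk exprD ler_wpM2l ?exprn_ge0 ?mulr_ge0 ?(ltW li) //.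
  apply: (@le_trans _ _ ((1 + lam^-1 * r) ^+ j)).
    rewrite lerXn2r ?nnegrE ?mulr_ge0 ?(ltW li) //; first by lra.
    by rewrite mulrDl mul1r [r * _]mulrC lerD2r.
  by rewrite bk exprD ler_peMl ?exprn_ge0 ?exprn_ege1 //; lra.
(* This is where [l <= l'] enters: [k] factors [l] are kept for the rate, the others are raised to
   [l'], and the missing [l' ^+ k] is restored through [(1 + l'^-1) ^+ k]. *)
have H2 : l ^+ b <= l ^+ k * (l' ^+ b * (1 + l'^-1) ^+ k).
  rewrite {1}bk exprD ler_wpM2l ?exprn_ge0 ?(ltW l0) //.
  apply: (@le_trans _ _ (l' ^+ j)).
    by rewrite lerXn2r ?nnegrE ?(ltW l0) ?(ltW l'0).
  rewrite bk exprD mulrAC -exprMn ler_peMl ?exprn_ge0 ?(ltW l'0) //.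
  by rewrite exprn_ege1 // mulrDr mulr1 mulfV ?gt_eqF // lerDr ltW.
(* Neither the maximum over [M j / j!] nor the powers of [d + 1] and [HM] arise for high orders;
   being at least 1 in these combinations, they are inserted to obtain the same bound as for low
   orders. *)
have AX : 1 <= AM * mmax k.
  apply: le_trans M0_ge _; rewrite ler_wpM2l //.
  by have := mmax_ge (leq0n k); rewrite fact0 divr1.
have dH : 1 <= (d%:R + 1) ^+ k * HM ^+ k.
  by rewrite -exprMn exprn_ege1 // -[leLHS]mulr1 ler_pM // lerDr.
rewrite [leLHS]mulrA.
apply: (@le_trans _ _ ((1 + r) ^+ k * lam^-1 ^+ k * (C * T * (l ^+ b * M b)))).
  apply: (@le_trans _ _ ((1 + r) ^+ k * lam^-1 ^+ k * (1 + lam^-1 * r) ^+ b * w)).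
    by rewrite ler_wpM2r.
  rewrite -mulrA ler_wpM2l //.
  by rewrite mulr_ge0 ?exprn_ge0 // ltW.
rewrite [leLHS](_ : _ = C * lam^-1 ^+ k * M b * ((1 + r) ^+ k * T * l ^+ b)); last by ring.
have K1 : 0 <= C * lam^-1 ^+ k * M b by rewrite !mulr_ge0 ?exprn_ge0 // ltW.
apply: (@le_trans _ _ (C * lam^-1 ^+ k * M b *
    (P * (l ^+ k * (l' ^+ b * (1 + l'^-1) ^+ k))))).
  rewrite ler_wpM2l // ler_pM ?exprn_ge0 ?(ltW l0) //.
  by rewrite mulr_ge0 ?exprn_ge0 //; lra.
have K2 : 0 <= l ^+ k * (l' ^+ b * (1 + l'^-1) ^+ k).
  by apply: le_trans H2; rewrite exprn_ge0 // ltW.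
apply: (@le_trans _ _ (C * lam^-1 ^+ k * M b *
    (P * (l ^+ k * (l' ^+ b * (1 + l'^-1) ^+ k))) *
    (2 * (AM * mmax k) * ((d%:R + 1) ^+ k * HM ^+ k)))).
  rewrite ler_peMr //; first by apply: mulr_ge0 => //; exact: mulr_ge0.
  move: AX dH; set u := AM * _; set v := _ ^+ k * _; nra.
rewrite le_eqVlt; apply/orP; left; apply/eqP.
rewrite /P /est_B /est_D /A_seq -exprVn !exprMn; ring.
Qed.

Lemma Kbound_crem (q lam l l' C : R) (phi : 'rV[R]_d -> R[i]) k :
  csmooth phi -> 0 < q -> 1 <= lam -> 0 < l -> l <= l' -> 0 <= C ->
  Kbound M N l q C phi ->
  Kbound M N l' (HN * q)
    (C * (est_B * (C0 + (N 0%N)^-1)) *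
      ((est_D q * l * (1 + l'^-1)) ^+ k * A_seq M N k / lam ^+ k))
    (crem k lam phi).
Proof.
move=> sp q0 lam1 l0 ll C00 H a x S wS.
have S1 := weight_le_ge1 N_pos wS.
have lam0 : 0 < lam by lra.
have l'0 : 0 < l' by lra.
have li : 0 < lam^-1 by rewrite invr_gt0.
have li1 : lam^-1 <= 1 by rewrite invf_le1.
have x0 := enorm_ge0 x.
pose T := Num.sqrt (S * AN * N 0%N).
have TS : T ^+ 2 = S * AN * N 0%N.
  by rewrite sqr_sqrtr // !mulr_ge0 // ?(ltW (N_pos _)) //; lra.
have wT : weight_le N (q * enorm x) T.
  apply: (weight_le_sqrt N_pos AN1 HN1 N_M2); first by rewrite mulr_ge0 // ltW.
  by rewrite mulrA.
have yx : enorm (lam^-1 *: x) <= enorm x.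
  by rewrite enormZ ?(ltW li) // ler_piMl.
rewrite mderiv_crem //.
have [ak|ka] := ltnP (mi_order a) k.
- have [] := Kbound_trem N_pos sp C00 (ltW l0) (ltW q0) H yx wT (ltnW ak).
  rewrite norm1Z ?(ltW li) //; set K := (X in _ <= X) => HR HI.
  have := @estimate_low q (enorm x) S T lam l l' C (norm1 x) k (mi_order a)
    (k - mi_order a) (subnKC (ltnW ak)) q0 x0 wT S1 TS lam1 l0 l'0 C00
    (norm1_ge0 x) (norm1_le x).
  apply: le_trans; rewrite -/K ler_wpM2l ?exprn_ge0 ?addr_ge0 //.
  apply: le_trans (cmod_le _ _) _.
  have lb : 0 <= lam^-1 ^+ mi_order a by rewrite exprn_ge0 // ltW.
  rewrite !normrM (ger0_norm lb) -mulrDr [leRHS]mulrCA ler_wpM2l //.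
  rewrite mulr_natl mulr2n; exact: lerD.
- have k0 : (k - mi_order a)%N = 0%N by apply/eqP; rewrite subn_eq0.
  have -> : Complex (lam^-1 ^+ mi_order a * trem (k - mi_order a)
             (rmderiv a (fun y => complex.Re (phi y))) (lam^-1 *: x))
          (lam^-1 ^+ mi_order a * trem (k - mi_order a)
             (rmderiv a (fun y => complex.Im (phi y))) (lam^-1 *: x)) =
      real_complex R (lam^-1 ^+ mi_order a) * mderiv a phi (lam^-1 *: x).
    apply/eqP; rewrite k0 eq_complex /= !mul0r subr0 addr0 /trem.
    by rewrite !tpoly0 !subr0 !eqxx.
  rewrite Normc.normcM cmod_real ger0_norm ?exprn_ge0 ?(ltW li) //.
  apply: estimate_high => //; first exact: cmod_ge0.
  rewrite -enormZ ?(ltW li) //.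
  exact: (Kbound_deriv N_pos a C00 (ltW l0) (ltW q0) H yx wT).
Qed.

End MainEstimate.

(** * The expansion *)

Section Expansion.
Variables (R : realType) (d : nat) (M N : nat -> R).
Hypotheses (M_pos : weight_seq M) (N_pos : weight_seq N).
Implicit Types (c : ultra_class) (phi : 'rV[R]_d -> R[i]).

Lemma Kbound_leC (l q C C' : R) phi : 0 <= l -> C <= C' ->
  Kbound M N l q C phi -> Kbound M N l q C' phi.
Proof.
move=> l0 CC H a x S wS; apply: le_trans (H a x S wS) _.
have S1 := weight_le_ge1 N_pos wS.
rewrite ler_wpM2r ?mulr_ge0 ?exprn_ge0 ?(ltW (M_pos _)) //.
by rewrite ler_wpM2r //; lra.
Qed.

(** The order of the quantifiers is what the two cases need. [h] precedes [q], since the Roumieu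
    case takes [q = t / h]; [B] and [D] precede [l] and [l'], since the Beurling case chooses [l] in
    terms of [D]. *)
Lemma crem_estimate : cond_M2 M -> cond_M2 N ->
  0 < inf [set N p `^ (p%:R^-1) | p in [set p : nat | (0 < p)%N]] ->
  exists2 h : R, 0 < h & forall q, 0 < q ->
    exists B D : R, [/\ 0 < B, 0 < D &
      forall (lam l l' C : R) phi k, csmooth phi ->
        1 <= lam -> 0 < l -> l <= l' -> 0 <= C -> Kbound M N l q C phi ->
        Kbound M N l' (h * q)
          (C * B * ((D * l * (1 + l'^-1)) ^+ k * A_seq M N k / lam ^+ k))
          (crem k lam phi)].
Proof.
move=> M_M2 N_M2 N_root.
have [AM [HM [AM1 HM1 {}M_M2]]] := cond_M2_ge1 M_pos M_M2.
have [AN [HN [AN1 HN1 {}N_M2]]] := cond_M2_ge1 N_pos N_M2.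
have [C0 [D0 [C01 D01 N_low]]] := root_lower_bound N_pos N_root.
exists HN => [|q q0]; first by lra.
exists (est_B N AM AN * (C0 + (N 0%N)^-1)), (est_D d HM D0 q); split.
- have Ni : 0 < (N 0%N)^-1 by rewrite invr_gt0.
  by rewrite /est_B !mulr_gt0 //; lra.
- have qi : 0 < q^-1 by rewrite invr_gt0.
  have d0 : 0 <= d%:R :> R by [].
  by rewrite /est_D !mulr_gt0 //; lra.
- move=> lam l l' C phi k sp lam1 l0 ll C00 H; exact: Kbound_crem.
Qed.

Lemma crem_decomposition k lam phi :
  (fun x => phi (lam^-1 *: x)) =
  fun x => 1 * crem k lam phi x + 1 * \sum_(a <- mis d k)
    (mderiv a phi 0 * real_complex R (lam^-1 ^+ mi_order a)) * cmonom a x.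
Proof.
apply/funext => x; rewrite !mul1r.
have -> : \sum_(a <- mis d k)
    (mderiv a phi 0 * real_complex R (lam^-1 ^+ mi_order a)) * cmonom a x =
    Complex (tpoly k (fun y => complex.Re (phi y)) (lam^-1 *: x))
            (tpoly k (fun y => complex.Im (phi y)) (lam^-1 *: x)).
  rewrite !tpoly_dilation; elim: (mis d k) => [|a s IH]; first by rewrite !big_nil.
  rewrite !big_cons IH; apply/eqP; rewrite eq_complex /= /cmonom.
  by apply/andP; split; apply/eqP; rewrite /=; ring.
apply/eqP; rewrite eq_complex /= /trem !subrK !eqxx; by case: (phi _).
Qed.

Variables (c : ultra_class) (f : ('rV[R]_d -> R[i]) -> R[i]).
Hypothesis f_dual : @Kdual R d c M N f.

(** The factorial undoes the one contained in [cmonom a], so this is the pairing of [f] with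
    [x^a]. *)
Definition moment (a : multi_index d) : R[i] := (mi_fact a)%:R * f (cmonom a).

(** Linearity of [f] is available on [Kspace] only, and [Kspace] is a union; the partial sums are
    therefore kept inside the single step of index 1, which contains all monomials. *)
Lemma Kdual_sum (r : seq (multi_index d)) (co : multi_index d -> R[i]) :
  @Kspace R d c M N (fun x => \sum_(a <- r) co a * cmonom a x) /\
  f (fun x => \sum_(a <- r) co a * cmonom a x) =
    \sum_(a <- r) co a * f (cmonom a).
Proof.
have [flin _] := f_dual.
have Km a : @Kstep R d c M N 1 (cmonom a) by exact: Kstep_cmonom.
suff [K1 E] : @Kstep R d c M N 1 (fun x => \sum_(a <- r) co a * cmonom a x) /\
    f (fun x => \sum_(a <- r) co a * cmonom a x) =
      \sum_(a <- r) co a * f (cmonom a) by split=> //; exists 1 => /=.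
elim: r => [|a r [IH1 IH2]].
  pose a : multi_index d := [ffun=> 0%N].
  have -> : (fun x : 'rV[R]_d => \sum_(a <- [::]) co a * cmonom a x) =
      fun x => 0 * cmonom a x + 0 * cmonom a x.
    by apply/funext => x; rewrite big_nil !mul0r addr0.
  split; first exact: Kstep_lin.
  by rewrite flin ?big_nil ?mul0r ?addr0 //; exists 1 => //=.
have -> : (fun x : 'rV[R]_d => \sum_(b <- a :: r) co b * cmonom b x) =
    fun x => co a * cmonom a x + 1 * \sum_(b <- r) co b * cmonom b x.
  by apply/funext => x; rewrite big_cons mul1r.
split; first exact: Kstep_lin.
by rewrite flin ?IH2 ?mul1r ?big_cons //; exists 1 => //=.
Qed.

Lemma UMAE_remainder k lam phi : 0 < lam -> csmooth phi ->
  @Kspace R d c M N (crem k lam phi) ->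
  dilated_pairing f lam phi - moment_sum moment phi lam k =
  real_complex R (lam ^- d) * f (crem k lam phi).
Proof.
move=> lam0 sp Kc; have [flin _] := f_dual.
rewrite /dilated_pairing (crem_decomposition k).
have [KS ES] := Kdual_sum (mis d k)
  (fun a => mderiv a phi 0 * real_complex R (lam^-1 ^+ mi_order a)).
rewrite flin // ES !mul1r mulrDr /moment_sum.
rewrite -(big_mis k (fun a => moment a * mderiv a phi 0 /
  ((mi_fact a)%:R * real_complex R (lam ^+ (mi_order a + d))))).
rewrite mulr_sumr -addrA -sumrB big1 ?addr0 // => a _.
apply/eqP; rewrite subr_eq0; apply/eqP; rewrite /moment.
have fa : (mi_fact a)%:R != 0 :> R[i].
  rewrite pnatr_eq0 -lt0n /mi_fact prodn_gt0 // => i; exact: fact_gt0.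
have lr : real_complex R lam != 0 by rewrite eq_complex /= eqxx andbT gt_eqF.
rewrite exprD rmorphM /= !rmorphXn /= !fmorphV /= !rmorphXn /=.
set z := real_complex R lam in lr *.
have z1 := expf_neq0 (mi_order a) lr; have z2 := expf_neq0 d lr.
rewrite exprVn; move: (z ^+ mi_order a) (z ^+ d) z1 z2 => u v u0 v0.
by field; rewrite fa u0 v0.
Qed.

Lemma UMAE_estimate_crem (A : nat -> R) phi (E l : R) : csmooth phi ->
  (forall k lam, 1 <= lam -> @Kspace R d c M N (crem k lam phi) /\
     cmod (f (crem k lam phi)) <= E * (l ^+ k * A k / lam ^+ k)) ->
  UMAE_estimate A f moment phi l.
Proof.
move=> sp H; exists E, 1; split=> // k lam lam1.
have lam0 : 0 < lam by lra.
have [Kc Hc] := H k lam lam1.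
rewrite UMAE_remainder // Normc.normcM cmod_real ger0_norm; last first.
  by rewrite invr_ge0 exprn_ge0 // ltW.
apply: le_trans (ler_wpM2l _ Hc) _; first by rewrite invr_ge0 exprn_ge0 // ltW.
by rewrite exprD invfM le_eqVlt; apply/orP; left; apply/eqP; ring.
Qed.

End Expansion.

Section Positivity.
Variables (R : realType) (B D l l' A lam : R) (k : nat).
Hypotheses (B0 : 0 < B) (D0 : 0 < D) (l0 : 0 < l) (l'0 : 0 < l') (A0 : 0 < A)
  (lam0 : 0 < lam).

Lemma estimate_gt0 (C : R) : 0 < C ->
  0 < C * B * ((D * l * (1 + l'^-1)) ^+ k * A / lam ^+ k).
Proof.
move=> C0; have l'1 : 0 < 1 + l'^-1 by rewrite addr_gt0 ?invr_gt0.
by apply: mulr_gt0; [exact: mulr_gt0 | rewrite divr_gt0 ?mulr_gt0 ?exprn_gt0 ?mulr_gt0].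
Qed.

Lemma estimate_ge0 (C : R) : 0 <= C ->
  0 <= C * B * ((D * l * (1 + l'^-1)) ^+ k * A / lam ^+ k).
Proof.
rewrite le_eqVlt => /predU1P[<-|C0]; first by rewrite !mul0r.
exact/ltW/estimate_gt0.
Qed.

End Positivity.

Theorem theorem7 (R : realType) (d : nat) (M N : nat -> R)
  (M_pos : weight_seq M) (N_pos : weight_seq N)
  (M_M1 : cond_M1 M) (M_M2 : cond_M2 M)
  (N_M1 : cond_M1 N) (N_M2 : cond_M2 N)
  (N_root : 0 < inf [set N p `^ (p%:R^-1) | p in [set p : nat | (0 < p)%N]])
  (c : ultra_class) (f : ('rV[R]_d -> R[i]) -> R[i])
  (f_dual : @Kdual R d c M N f) :
  UMAE c (@Kspace R d c M N) (A_seq M N) f.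
Proof.
exists (moment f) => phi [s /= s0 Ks].
have [sp Hphi] := (KstepP M_pos N_pos c phi s0).1 Ks.
have [h h0 est] := crem_estimate d M_pos N_pos M_M2 N_M2 N_root.
have A0 k : 0 < A_seq M N k by exact: A_seq_gt0.
case: c => /= in f_dual Ks Hphi *.
- move=> l0 l00.
  (* Here the step index is the exponent [q], which the estimate enlarges from [s] to [h * s];
     continuity of [f] is used on that larger step and yields the length [t]. *)
  have hs : 0 < h * s by rewrite mulr_gt0.
  have [t [Bf [t0 Bf0 Hf]]] := Kdual_bound M_pos N_pos f_dual hs.
  have [B [D [B0 D0 H]]] := est s s0.
  have tt : 0 < 1 + t^-1 by rewrite addr_gt0 ?invr_gt0.
  (* The first entry ensures [l <= t], as the estimate requires; the second brings the rate
     [D * l * (1 + t^-1)] below the prescribed [l0]. *)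
  pose l := Num.min t (l0 / (D * (1 + t^-1))).
  have l1 : 0 < l by rewrite lt_min t0 divr_gt0 // mulr_gt0.
  have lt : l <= t by rewrite ge_min lexx.
  have Dl : D * l * (1 + t^-1) <= l0.
    by rewrite mulrAC mulrC -ler_pdivlMr ?mulr_gt0 // ge_min lexx orbT.
  have [C C0 HC] := Hphi l l1.
  apply: (UMAE_estimate_crem (E := Bf * ((C + 1) * B)) M_pos N_pos f_dual) => // k lam lam1.
  have lam0 : 0 < lam by lra.
  (* Membership only asks for some finite bound at each length [u], so the estimate is applied with
     both lengths equal to [u]. *)
  have Kc : @Kstep R d Beurling M N (h * s) (crem k lam phi).
    apply/(KstepP M_pos N_pos _ _ hs); split=> [|u u0]; first exact: csmooth_crem.
    have [Cu Cu0 HCu] := Hphi u u0.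
    have := H lam u u Cu phi k sp lam1 u0 (lexx u) Cu0 HCu.
    set E := (X in Kbound _ _ _ _ X _) => HE; exists E => //.
    exact: estimate_ge0.
  split; first by exists (h * s).
  (* [C] may be 0, while [Kdual_bound] needs a positive constant. *)
  have HC1 : Kbound M N l s (C + 1) phi.
    by apply: (Kbound_leC M_pos N_pos _ _ HC); rewrite ?lerDl // ltW.
  have C10 : 0 < C + 1 by lra.
  have HE := H lam l t (C + 1) phi k sp lam1 l1 lt (ltW C10) HC1.
  apply: le_trans (Hf _ _ _ Kc HE) _; first exact: estimate_gt0.
  rewrite -[leRHS]mulrA ler_wpM2l ?(ltW Bf0) // ler_wpM2l ?mulr_ge0 ?(ltW C10) ?(ltW B0) //.
  rewrite ler_wpM2r ?invr_ge0 ?exprn_ge0 ?(ltW lam0) // ler_wpM2r ?(ltW (A0 k)) //.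
  by rewrite lerXn2r ?nnegrE ?(ltW l00) // !mulr_ge0 ?(ltW D0) ?(ltW l1) ?(ltW tt).
- have [t [Bf [t0 Bf0 Hf]]] := Kdual_bound M_pos N_pos f_dual s0.
  (* Now the step index is the length and [t] is an exponent; [phi] is bounded for every exponent,
     and [t / h] is the one that the estimate turns into [t]. *)
  have th : 0 < t / h by rewrite divr_gt0.
  have [B [D [B0 D0 H]]] := est _ th.
  have ss : 0 < 1 + s^-1 by rewrite addr_gt0 ?invr_gt0.
  (* Both lengths are [s], the index of a step containing [phi]; the rate therefore depends on
     [phi], as the Roumieu case allows. *)
  exists (D * s * (1 + s^-1)); first by rewrite !mulr_gt0.
  have [C C0 HC] := Hphi _ th.
  apply: (UMAE_estimate_crem (E := Bf * ((C + 1) * B)) M_pos N_pos f_dual) => // k lam lam1.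
  have lam0 : 0 < lam by lra.
  have Kc : @Kstep R d Roumieu M N s (crem k lam phi).
    apply/(KstepP M_pos N_pos _ _ s0); split=> [|u u0]; first exact: csmooth_crem.
    have uh : 0 < u / h by rewrite divr_gt0.
    have [Cu Cu0 HCu] := Hphi _ uh.
    have [B' [D' [B'0 D'0 H']]] := est _ uh.
    have := H' lam s s Cu phi k sp lam1 s0 (lexx s) Cu0 HCu.
    rewrite [h * _]mulrC divfK ?gt_eqF //.
    set E := (X in Kbound _ _ _ _ X _) => HE; exists E => //.
    exact: estimate_ge0.
  split; first by exists s.
  have HC1 : Kbound M N s (t / h) (C + 1) phi.
    by apply: (Kbound_leC M_pos N_pos _ _ HC); rewrite ?lerDl // ltW.
  have C10 : 0 < C + 1 by lra.
  have := H lam s s (C + 1) phi k sp lam1 s0 (lexx s) (ltW C10) HC1.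
  rewrite [h * _]mulrC divfK ?gt_eqF // => HE.
  rewrite -[leRHS]mulrA; apply: (Hf _ _ _ Kc HE); exact: estimate_gt0.
Qed.
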